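(* Fix $\rho>0$ satisfying $H(\rho)+\rho<1$. There are constants $d_0, C_1, C_1', C_2>0$, all depending on $\rho$, such that the following holds. Let $\Sigma$ be a $d$-regular bipartite graph on $N$ vertices with bipartite expansion $\delta$ and locality $\ell>0$ satisfying $$\delta \geq \max\left\{\frac{C_1\log^3 d}{d},\frac{C_1'\log d}{\ell}\right\}$$ and with $d\geq d_0$. If $\mathcal{M}(\Sigma)$ is an ergodic $\rho$-local Markov chain on state space $\mathcal{C}_3(\Sigma)$ with stationary distribution $\pi_3(\Sigma)$, then $$\tau_{\mathcal{M}(\Sigma)} \geq 2^{\,C_2N\delta/\log d}.$$
   Context: All graphs are finite, simple and loopless. $\log=\log_2$, and $H(x)=-x\log x-(1-x)\log(1-x)$ is the binary entropy function on $[0,1]$ (with $0\log 0=0$). Let $\Sigma=(V,E)$ be a $d$-regular bipartite graph with partition classes $\mathcal{E}$ and $\mathcal{O}$. For $u,v\in V$ write $u\sim v$ if $u,v$ are adjacent; $N(u)=\{w\in V: w\sim u\}$ and $N(A)=\bigcup_{w\in A}N(w)$ for $A\subseteq V$. For $A\subseteq\mathcal{E}$ (or $A\subseteq\mathcal{O}$) set $[A]=\{x\in V: N(x)\subseteq N(A)\}$, and call $A$ small if $|[A]|\leq |V|/4$. The bipartite expansion of $\Sigma$ is $$\delta(\Sigma)=\min\left\{\frac{|N(A)|-|[A]|}{|N(A)|}: A\subseteq\mathcal{E}\ (\text{or } A\subseteq\mathcal{O}),\ A \text{ small},\ A\neq\emptyset\right\}.$$ The locality $\ell(\Sigma)$ is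 the largest $\ell\geq 0$ such that for all adjacent $x\sim y$ in $V$ and all independent sets $I$ in the subgraph of $\Sigma$ induced by $N(x)\cup N(y)$ we have $|I|\leq 2d-\ell$. $\mathcal{C}_3(\Sigma)$ is the set of proper $3$-colourings $\chi:V\to\{0,1,2\}$ (i.e. $\chi(x)\neq\chi(y)$ whenever $x\sim y$), and $\pi_3(\Sigma)$ is the uniform probability distribution on $\mathcal{C}_3(\Sigma)$. A Markov chain $\mathcal{M}$ on $\mathcal{C}_3(\Sigma)$ with transition probabilities $P_{\mathcal{M}}$ is $\rho$-local if $P_{\mathcal{M}}(\chi_1,\chi_2)\neq 0$ implies $|\{v\in V:\chi_1(v)\neq\chi_2(v)\}|\leq\rho|V|$. Ergodic means irreducible and aperiodic. The mixing time of a chain $\mathcal{M}$ on a finite state space $\Omega$ with transition probabilities $P$ and stationary distribution $\pi$ is $\tau_{\mathcal{M}}=\min\{t: d_{TV}(P^t,\pi)\leq 1/e\}$, where $P^t(x,y)$ is the $t$-step transition probability and $d_{TV}(P^t,\pi)=\max_{x\in\Omega}\frac12\sum_{y\in\Omega}|P^t(x,y)-\pi(y)|$. *)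

(* Defs.v *)
From mathcomp Require Import all_boot all_order all_algebra.
From mathcomp Require Import boolp classical_sets reals sequences exp.

Set Implicit Arguments.
Unset Strict Implicit.
Unset Printing Implicit Defensive.

Import Order.TTheory GRing.Theory Num.Theory.
Local Open Scope ring_scope.

(* The library's [min]-like big operators need a default value on the empty
   family.  Minima and maxima of possibly empty or infinite families are
   therefore predicates: the extremum has to be attained. *)
Section Extrema.
Variables (disp : Order.disp_t) (T : porderType disp).
Implicit Types (S : set T) (m : T).

Definition is_min S m : Prop := S m /\ lbound S m.
Definition is_max S m : Prop := S m /\ ubound S m.

End Extrema.

Section Entropy.
Variable R : realType.
Implicit Type x : R.

Definition log2 x : R := ln x / ln 2.

(* [0 * log 0 = 0] holds whatever the value of [ln 0]. *)
Definition binary_entropy x : R := - x * log2 x - (1 - x) * log2 (1 - x).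

End Entropy.

Record sgraph := SGraph {
  vertex :> finType;
  adj : rel vertex;
  adj_sym : symmetric adj;
  adj_irrefl : irreflexive adj
}.

Section Graphs.
Variable G : sgraph.
Implicit Types (A E O I : {set G}) (x y u v : G).

Definition neighbours x : {set G} := [set y | adj x y].

Definition neighbourhood A : {set G} := \bigcup_(x in A) neighbours x.

Definition regular (d : nat) : Prop := forall x, #|neighbours x| = d.

Definition bipartition E O : Prop :=
  [/\ E :|: O = [set: G], [disjoint E & O] &
      forall x y, adj x y ->
        (x \in E /\ y \in O) \/ (x \in O /\ y \in E)].

Definition bip_closure A : {set G} :=
  [set x | neighbours x \subset neighbourhood A].

Definition small A : Prop := (4 * #|bip_closure A| <= #|G|)%N.

Definition expansion_ratio (R : realType) A : R :=
  (#|neighbourhood A|%:R - #|bip_closure A|%:R) / #|neighbourhood A|%:R.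

Definition is_bip_expansion (R : realType) E O (delta : R) : Prop :=
  is_min [set r | exists A, [/\ A \subset E \/ A \subset O, small A,
                              A != finset.set0 & r = expansion_ratio R A]]%classic
    delta.

Definition independent I : Prop := {in I &, forall u v, ~~ adj u v}.

(* [#|I| <= 2 d - l], stated without truncated subtraction. *)
Definition local_sparsity (d l : nat) : Prop :=
  forall x y, adj x y ->
  forall I, I \subset neighbours x :|: neighbours y -> independent I ->
    (#|I| + l <= 2 * d)%N.

Definition is_locality (d l : nat) : Prop :=
  is_max [set k | local_sparsity d k]%classic l.

End Graphs.

Definition proper_colouring (G : sgraph) (chi : {ffun G -> 'I_3}) : bool :=
  [forall x, forall y, adj x y ==> (chi x != chi y)].

Definition colouring (G : sgraph) : finType :=
  {chi : {ffun G -> 'I_3} | proper_colouring chi}.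

Section MarkovChains.
Variables (R : realType) (Omega : finType).
Implicit Types (P : Omega -> Omega -> R) (pi : Omega -> R).

Definition stochastic P : Prop :=
  (forall x y, 0 <= P x y) /\ (forall x, \sum_y P x y = 1).

Fixpoint step_prob P (t : nat) (x y : Omega) : R :=
  if t is t'.+1 then \sum_z P x z * step_prob P t' z y else (x == y)%:R.

Definition irreducible P : Prop :=
  forall x y, exists t, 0 < step_prob P t x y.

(* The gcd of the return times of every state is 1. *)
Definition aperiodic P : Prop :=
  forall (x : Omega) (g : nat),
    (forall t, (0 < t)%N -> 0 < step_prob P t x x -> (g %| t)%N) -> g = 1%N.

Definition ergodic P : Prop := irreducible P /\ aperiodic P.

Definition stationary P pi : Prop := forall y, \sum_x pi x * P x y = pi y.

Definition uniform : Omega -> R := fun=> #|Omega|%:R^-1.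

Definition tv_dist P (t : nat) pi : R :=
  \big[Num.max/0]_x (2^-1 * \sum_y `|step_prob P t x y - pi y|).

Definition is_mixing_time P pi (tau : nat) : Prop :=
  is_min [set t | tv_dist P t pi <= (expR 1)^-1]%classic tau.

End MarkovChains.

Arguments uniform R Omega : clear implicits.

Definition local_chain (R : realType) (G : sgraph) (rho : R)
    (P : colouring G -> colouring G -> R) : Prop :=
  forall chi1 chi2, P chi1 chi2 != 0 ->
    #|[set v | val chi1 v != val chi2 v]|%:R <= rho * #|G|%:R.

(* Main.v *)
Require Import Defs.
From mathcomp Require Import all_boot all_order all_algebra perm.
From mathcomp Require Import reals sequences exp.
From mathcomp Require Import zify ring lra.
Import Order.TTheory GRing.Theory Num.Theory.
Local Open Scope ring_scope.

(** Write n = |E| = |O|. For a colour c let f(chi) be the number of vertices of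
    E coloured c minus the number of vertices of O coloured c. A rho-local move
    changes f by at most 2 rho n, so to pass from {f > rho n} to {f < - rho n}
    the chain has to visit the barrier {|f| <= rho n}. Permuting the colours
    shows that both sides have measure close to 1/3 at least, hence the mixing
    time is at least a constant times the inverse of the measure of the barrier.
    There are at least 2^n proper colourings, so it suffices to bound the size of
    the barrier by 2^(n - c delta n).

    Call a colouring dominated on a side if one colour is used on all but a
    fraction 2 eps of this side. Dominated colourings in the barrier are few by
    a Chernoff bound, because the entropy condition forces rho < 1/2. For the
    other ones, reveal the colours on a dominating set of O(n log d / d)
    vertices, after which each vertex has at most two possible colours, and then
    branch on the colour of any undecided vertex that has at least d/8 undecided
    neighbours. This costs a factor 2^(O(n log d / d)) and reaches list
    assignments whose undecided vertices span a graph of maximum degree < d/8. If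
    such an assignment has m undecided vertices and mu is the size of a maximal
    matching between them, it admits at most 2^m (3/4)^mu colourings. Counting
    edges gives m <= n + mu/4; outside the matching, the undecided vertices of E
    with the same missing colour i have their neighbours among the vertices of O
    where i is forced, so expansion gives n - m >= delta eps n - 4 mu unless one
    side is dominated. Together, m - 2 mu / 5 <= n - delta eps n / 25. *)

Set Implicit Arguments.
Unset Strict Implicit.
Unset Printing Implicit Defensive.

(** * Double counting in regular bipartite graphs *)

Section GraphCounting.
Variable G : sgraph.
Implicit Types (A B S : {set G}) (x y u v : G).

Lemma in_neighbours x y : (y \in neighbours x) = adj x y.
Proof. by rewrite in_set. Qed.

Lemma neighboursC x y : (y \in neighbours x) = (x \in neighbours y).
Proof. by rewrite !in_neighbours adj_sym. Qed.

Lemma in_neighbourhood A y :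
  reflect (exists2 x, x \in A & adj x y) (y \in neighbourhood A).
Proof.
apply: (iffP bigcupP) => -[x xA].
  by rewrite in_neighbours => xy; exists x.
by move=> xy; exists x => //; rewrite in_neighbours.
Qed.

Lemma edge_count_sym A B :
  (\sum_(x in A) #|neighbours x :&: B| = \sum_(y in B) #|neighbours y :&: A|)%N.
Proof.
transitivity (\sum_(x in A) \sum_(y in B) (adj x y : nat))%N.
  apply: eq_bigr => x _; rewrite -sum1_card big_mkcond [RHS]big_mkcond /=.
  apply: eq_bigr => y _; rewrite in_setI in_neighbours.
  by case: (adj x y); case: (y \in B).
rewrite exchange_big /=; apply: eq_bigr => y _.
rewrite -sum1_card big_mkcond [RHS]big_mkcond /=.
apply: eq_bigr => x _; rewrite in_setI in_neighbours adj_sym.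
by case: (adj y x); case: (x \in A).
Qed.

Section Regular.
Variables (d : nat) (dreg : regular G d).

Lemma edge_count_neighbourhood A B :
  neighbourhood A \subset B ->
  (\sum_(x in A) #|neighbours x :&: B| = d * #|A|)%N.
Proof.
move=> /subsetP NAB; rewrite mulnC -sum_nat_const; apply: eq_bigr => x xA.
rewrite (setIidPl _) ?dreg //; apply/subsetP => y; rewrite in_neighbours => xy.
by apply: NAB; apply/in_neighbourhood; exists x.
Qed.

Lemma edge_count_le A B :
  (\sum_(x in A) #|neighbours x :&: B| <= d * #|A|)%N.
Proof.
rewrite mulnC -sum_nat_const; apply: leq_sum => x _.
by rewrite -(dreg x) subset_leq_card // subsetIl.
Qed.

(** The [d * #|A|] edges leaving [A] all end in [B], where each vertex absorbs at most [d] of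
    them. *)
Lemma card_neighbourhood_ge A B :
  (0 < d)%N -> neighbourhood A \subset B -> (#|A| <= #|B|)%N.
Proof.
move=> d_gt0 NAB; rewrite -(leq_pmul2l d_gt0) -(edge_count_neighbourhood NAB).
by rewrite edge_count_sym edge_count_le.
Qed.

Lemma bip_closure_sub A : A \subset bip_closure A.
Proof.
apply/subsetP => x xA; rewrite inE; apply/subsetP => y; rewrite in_neighbours.
by move=> xy; apply/in_neighbourhood; exists x.
Qed.

Lemma neighbourhood_closure A : neighbourhood (bip_closure A) \subset neighbourhood A.
Proof.
apply/subsetP => y /in_neighbourhood [x]; rewrite inE => /subsetP NxA xy.
by apply: NxA; rewrite in_neighbours.
Qed.

Variables (E O : {set G}).
Hypothesis bip : bipartition E O.

Lemma bipartitionC : bipartition O E.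
Proof.
case: bip => EO dEO h; split; first by rewrite setUC.
  by rewrite disjoint_sym.
by move=> x y /h [] []; [right|left].
Qed.

Lemma notin_bipartition x : (x \notin E) = (x \in O).
Proof.
case: bip => EO dEO _; have : x \in E :|: O by rewrite EO in_setT.
rewrite in_setU; case: (boolP (x \in E)) => [xE _|_ /= -> //].
by rewrite (disjointFr dEO xE).
Qed.

Lemma adj_bipartition x y : adj x y -> (x \in E) = (y \in O).
Proof.
case: bip => _ dEO h /h [] [xE yO]; first by rewrite xE yO.
by rewrite (disjointFl dEO xE) (disjointFr dEO yO).
Qed.

Lemma neighbourhood_side A : A \subset E -> neighbourhood A \subset O.
Proof.
move=> /subsetP AE; apply/subsetP => y /in_neighbourhood [x xA xy].
by rewrite -(adj_bipartition xy) AE.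
Qed.

End Regular.

Lemma card_bipartition d (E O : {set G}) :
  (0 < d)%N -> regular G d -> bipartition E O ->
  #|E| = #|O| /\ #|G| = (2 * #|E|)%N.
Proof.
move=> d_gt0 dreg bip; have bip' := bipartitionC bip.
have eEO : #|E| = #|O|.
  by apply/eqP; rewrite eqn_leq !(card_neighbourhood_ge dreg d_gt0) //;
    apply: (neighbourhood_side (E := _)); eauto.
split=> //; rewrite mul2n -addnn {2}eEO -cardsT.
case: bip => <- dEO _; rewrite cardsU (_ : E :&: O = set0) ?cards0 ?subn0 //.
by apply/eqP; rewrite setI_eq0.
Qed.

Lemma closure_side d (E O A : {set G}) :
  (0 < d)%N -> regular G d -> bipartition E O -> A \subset E ->
  bip_closure A \subset E.
Proof.
move=> d_gt0 dreg bip AE; apply/subsetP => x; rewrite inE => /subsetP NxA.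
have : neighbours x != set0 by rewrite -card_gt0 dreg.
case/set0Pn => y yx; have yO := subsetP (neighbourhood_side bip AE) _ (NxA _ yx).
by move: yx; rewrite in_neighbours => /(adj_bipartition bip) ->.
Qed.

End GraphCounting.

(** * Expansion of arbitrary subsets of one side *)

Section Expansion.
Variables (R : realType) (G : sgraph).

Lemma is_bip_expansionC (E O : {set G}) (delta : R) :
  is_bip_expansion E O delta -> is_bip_expansion O E delta.
Proof.
case=> [[A [AEO sA A0 ->]] lb]; split; first by exists A; split=> //; tauto.
by move=> _ [B [BEO sB B0 ->]]; apply: lb; exists B; split=> //; tauto.
Qed.

Variables (E O : {set G}) (d : nat) (delta : R).
Hypotheses (d_gt0 : (0 < d)%N) (dreg : regular G d) (bip : bipartition E O).
Hypothesis dmin : is_bip_expansion E O delta.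

Lemma card_neighbourhood_gt0 (A : {set G}) :
  A != set0 -> (0 < #|neighbourhood A|)%N.
Proof.
move=> A0; apply: leq_trans (card_neighbourhood_ge dreg d_gt0 (subxx _)).
by rewrite card_gt0.
Qed.

Lemma bip_expansion_le1 : delta <= 1.
Proof.
case: dmin => -[A [_ _ A0 ->]] _; rewrite /expansion_ratio.
have N0 := card_neighbourhood_gt0 A0.
rewrite ler_pdivrMr ?ltr0n // mul1r lerBlDr lerDl; exact: ler0n.
Qed.

Lemma card_gt0_of_expansion : (0 < #|G|)%N.
Proof.
case: dmin => -[A [_ _ /set0Pn [x _] _]] _; rewrite -cardsT card_gt0.
by apply/set0Pn; exists x; rewrite inE.
Qed.

Lemma degree_le_side : (d <= #|E|)%N.
Proof.
have /card_gt0P [x _] := card_gt0_of_expansion.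
rewrite -(dreg x); have [eEO _] := card_bipartition d_gt0 dreg bip.
have [xE|] := boolP (x \in E).
  rewrite eEO; apply: subset_leq_card; apply/subsetP => y.
  by rewrite in_neighbours => /(adj_bipartition bip) <-.
rewrite (notin_bipartition bip) => xO; apply: subset_leq_card; apply/subsetP => y.
by rewrite in_neighbours adj_sym => /(adj_bipartition bip) ->.
Qed.

Lemma small_expansion (A : {set G}) :
  A \subset E \/ A \subset O -> small A -> A != set0 ->
  delta * #|neighbourhood A|%:R <= #|neighbourhood A|%:R - #|bip_closure A|%:R.
Proof.
move=> AEO sA A0; have N0 := card_neighbourhood_gt0 A0.
rewrite -ler_pdivlMr ?ltr0n //; case: dmin => _; apply.
by exists A.
Qed.

(* If the closure of [S] is not small, the expansion hypothesis applies to
   [O :\: neighbourhood S], whose neighbourhood avoids the closure of [S]. *)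
Lemma expansion_dichotomy (S : {set G}) :
  0 <= delta -> S \subset E ->
  delta * #|S|%:R <= #|neighbourhood S|%:R - #|S|%:R \/
  delta * (#|O|%:R - #|neighbourhood S|%:R) <= #|neighbourhood S|%:R - #|S|%:R.
Proof.
move=> delta_ge0 SE; have [eEO cG] := card_bipartition d_gt0 dreg bip.
have [->|S0] := eqVneq S set0.
  by left; rewrite cards0 mulr0 subr0.
have SclS : (#|S| <= #|bip_closure S|)%N by rewrite subset_leq_card ?bip_closure_sub.
have clSN : (#|bip_closure S| <= #|neighbourhood S|)%N.
  by apply: (card_neighbourhood_ge dreg d_gt0); exact: neighbourhood_closure.
have [sS|/negP nsS] := boolP (4 * #|bip_closure S| <= #|G|)%N.
  left; have := small_expansion (or_introl SE) sS S0.
  have : (#|S|%:R <= #|bip_closure S|%:R :> R) by rewrite ler_nat.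
  have : (#|bip_closure S|%:R <= #|neighbourhood S|%:R :> R) by rewrite ler_nat.
  by nra.
right; set W := O :\: neighbourhood S.
have NO := neighbourhood_side bip SE.
have cW : #|W|%:R = #|O|%:R - #|neighbourhood S|%:R :> R.
  have := cardsID (neighbourhood S) O; rewrite (setIidPr NO) -/W => <-.
  by rewrite natrD addrAC subrr add0r.
rewrite -cW.
have [W0|W0] := eqVneq W set0.
  by rewrite W0 cards0 mulr0 subr_ge0 ler_nat (leq_trans SclS clSN).
have WO : W \subset O by apply: subsetDl.
have NWE := neighbourhood_side (bipartitionC bip) WO.
have NW : (#|neighbourhood W| + #|bip_closure S| <= #|E|)%N.
  have dis : [disjoint neighbourhood W & bip_closure S].
    rewrite -setI_eq0; apply/eqP/setP => x; rewrite !inE; apply/negP => /andP [].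
    case/in_neighbourhood => y; rewrite inE => /andP [yN _] yx /subsetP NxS.
    by case/negP: yN; apply: NxS; rewrite in_neighbours adj_sym.
  have := leq_card_setU (neighbourhood W) (bip_closure S); case=> _.
  rewrite dis => /eqP <-; apply: subset_leq_card; rewrite subUset NWE /=.
  exact: closure_side d_gt0 dreg bip SE.
have clW : (#|bip_closure W| <= #|neighbourhood W|)%N.
  by apply: (card_neighbourhood_ge dreg d_gt0); exact: neighbourhood_closure.
have WclW : (#|W| <= #|bip_closure W|)%N by rewrite subset_leq_card ?bip_closure_sub.
(* The closure of [S] fills more than half of [E], so the neighbourhood of [W] fills less than half,
   and it bounds the closure of [W]. *)
have sW : small W by rewrite /small cG; lia.
have := small_expansion (or_intror WO) sW W0.
have : (#|W|%:R <= #|bip_closure W|%:R :> R) by rewrite ler_nat.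
have : (#|bip_closure W|%:R <= #|neighbourhood W|%:R :> R) by rewrite ler_nat.
have : (#|neighbourhood W|%:R + #|bip_closure S|%:R <= #|E|%:R :> R) by rewrite -natrD ler_nat.
have : (#|S|%:R <= #|bip_closure S|%:R :> R) by rewrite ler_nat.
rewrite eEO; move: cW; nra.
Qed.

End Expansion.

(** * Greedy construction of a small dominating set *)

Section Domination.
Variables (R : realType) (G : sgraph) (d : nat).
Hypotheses (d_gt0 : (0 < d)%N) (dreg : regular G d) (G_gt0 : (0 < #|G|)%N).
Implicit Types (T U : {set G}).

Definition undominated T : {set G} := [set v | [disjoint neighbours v & T]].

(** Averaging: the numbers [#|neighbours v :&: U|] sum to [d * #|U|] over all vertices [v]. *)
Lemma greedy_cover U :
  exists v, (d * #|U| <= #|neighbours v :&: U| * #|G|)%N.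
Proof.
apply/existsP; apply: contraT; rewrite negb_exists => /forallP noU.
have : (\sum_(v : G) #|neighbours v :&: U| = d * #|U|)%N.
  rewrite -(edge_count_neighbourhood dreg (subsetT _)) edge_count_sym.
  by apply: eq_bigl => v; rewrite inE.
move=> /(congr1 (muln #|G|)); rewrite big_distrr /=.
suff : (\sum_(v : G) #|G| * #|neighbours v :&: U| < \sum_(v : G) d * #|U|)%N.
  by move=> /[swap] ->; rewrite sum_nat_const ltnn.
have /card_gt0P [v0 _] := G_gt0.
rewrite (bigD1 v0) //= [X in (_ < X)%N](bigD1 v0) //= -addSn leq_add //.
  by have := noU v0; rewrite -ltnNge mulnC.
by apply: leq_sum => v _; have := noU v; rewrite -ltnNge mulnC => /ltnW.
Qed.

Lemma degree_le_card : (d <= #|G|)%N.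
Proof. by have /card_gt0P [v _] := G_gt0; rewrite -(dreg v) max_card. Qed.

Lemma greedy_domination t :
  exists T, (#|T| <= t)%N /\
    (#|undominated T|%:R <= #|G|%:R * (1 - d%:R / #|G|%:R) ^+ t :> R).
Proof.
have N_gt0 : 0 < #|G|%:R :> R by rewrite ltr0n.
have dN : d%:R <= #|G|%:R :> R by rewrite ler_nat degree_le_card.
elim: t => [|t [T [cT uT]]].
  by exists set0; rewrite cards0 expr0 mulr1 ler_nat max_card.
have [v vU] := greedy_cover (undominated T).
exists (v |: T); split; first by rewrite cardsU1; case: (v \notin T); lia.
have sub : (#|undominated (v |: T)| + #|neighbours v :&: undominated T|
             <= #|undominated T|)%N.
  rewrite -(cardsID (neighbours v) (undominated T)) addnC setIC leq_add2l.
  apply: subset_leq_card; apply/subsetP => x; rewrite !inE => dx.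
  rewrite (disjointWr _ dx) ?subsetUr // andbT.
  apply/negP => vx; have := disjointFl dx (setU11 v T).
  by rewrite in_neighbours adj_sym vx.
have {}sub : #|undominated (v |: T)|%:R + #|neighbours v :&: undominated T|%:R
             <= #|undominated T|%:R :> R by rewrite -natrD ler_nat.
have {}vU : d%:R / #|G|%:R * #|undominated T|%:R <= #|neighbours v :&: undominated T|%:R :> R.
  by rewrite mulrAC ler_pdivrMr // -!natrM ler_nat.
have c_ge0 : 0 <= 1 - d%:R / #|G|%:R :> R by rewrite subr_ge0 ler_pdivrMr // mul1r.
rewrite exprS; set q := (1 - _) in uT c_ge0 *.
apply: le_trans (_ : q * #|undominated T|%:R <= _); first by rewrite /q; lra.
by rewrite mulrCA ler_wpM2l.
Qed.

(** About [s = (#|G| / d) * ln d] greedy rounds shrink the undominated set by a factor at most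
    [expR (- ln d)], to at most [#|G| / d] vertices; one neighbour of each of these is then added.
    The constant 3 absorbs these and the rounding of [s]. *)
Lemma dominating_set : exists T,
  (forall v, exists2 u, u \in T & adj v u) /\
  (#|T|%:R <= #|G|%:R / d%:R * (ln d%:R + 3) :> R).
Proof.
have N_gt0 : 0 < #|G|%:R :> R by rewrite ltr0n.
have d_gt0R : 0 < d%:R :> R by rewrite ltr0n.
have dN : d%:R <= #|G|%:R :> R by rewrite ler_nat degree_le_card.
have ln_ge0' : 0 <= ln d%:R :> R by apply: ln_ge0; rewrite ler1n.
set s : R := #|G|%:R / d%:R * ln d%:R.
have s_ge0 : 0 <= s by rewrite mulr_ge0 // divr_ge0.
have [T [cT uT]] := greedy_domination (Num.truncn s).+1.
pose f (v : G) : G := odflt v [pick u in neighbours v].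
have fP v : adj v (f v).
  rewrite /f; case: pickP => [u|]; first by rewrite in_neighbours.
  have : (0 < #|neighbours v|)%N by rewrite dreg.
  by case/card_gt0P => u uv /(_ u); rewrite uv.
exists (T :|: f @: undominated T); split=> [v|].
  have [dv|] := boolP (v \in undominated T).
    by exists (f v) => //; rewrite inE (imset_f f dv) orbT.
  rewrite inE => /pred0Pn [u /andP [/= uv uT']].
  by exists u; rewrite ?inE ?uT' // -in_neighbours.
have cTf : (#|T :|: f @: undominated T| <= #|T| + #|undominated T|)%N.
  by apply: leq_trans (leq_card_setU _ _) _; rewrite leq_add2l leq_imset_card.
have {}cTf : #|T :|: f @: undominated T|%:R <= #|T|%:R + #|undominated T|%:R :> R.
  by rewrite -natrD ler_nat.
have T_le : #|T|%:R <= s + 1.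
  apply: le_trans (_ : (Num.truncn s).+1%:R <= _); first by rewrite ler_nat.
  by rewrite -natr1 lerD2r truncn_le.
have Nd_ge1 : 1 <= #|G|%:R / d%:R :> R by rewrite ler_pdivlMr // mul1r.
suff U_le : #|undominated T|%:R <= #|G|%:R / d%:R :> R.
  by move: cTf T_le Nd_ge1 U_le; rewrite /s; clear; lra.
apply: le_trans uT _; rewrite ler_pM2l //.
have q_ge0 : 0 <= 1 - d%:R / #|G|%:R :> R by rewrite subr_ge0 ler_pdivrMr // mul1r.
have q_le : 1 - d%:R / #|G|%:R <= expR (- (d%:R / #|G|%:R)) :> R.
  exact: expR_ge1Dx.
apply: le_trans (lerXn2r _ _ _ q_le) _; rewrite ?nnegrE ?expR_ge0 //.
rewrite -expRM_natl -[X in _ <= X]lnK ?posrE ?invr_gt0 // ler_expR lnV ?posrE //.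
rewrite mulrN lerN2.
have /ltW : s < (Num.truncn s).+1%:R by rewrite truncnS_gt.
have -> : ln d%:R = s * (d%:R / #|G|%:R).
  by rewrite /s; field; rewrite !gt_eqF.
by move=> h; rewrite ler_wpM2r // divr_ge0.
Qed.
End Domination.

(** * List colourings: propagation and branching *)

Lemma card_le_fibers (X Y : finType) (f : X -> Y) (A : {set X}) (C : {set Y}) (k : nat) :
  (forall x, x \in A -> f x \in C) ->
  (forall y, y \in C -> #|[set x in A | f x == y]| <= k)%N ->
  (#|A| <= #|C| * k)%N.
Proof.
move=> fAC fib; rewrite -sum1_card (partition_big f (mem C)) //=.
rewrite -sum_nat_const; apply: leq_sum => y yC.
apply: leq_trans (fib y yC); rewrite -sum1_card.
by rewrite (eq_bigl (fun x => x \in [set x in A | f x == y])) // => x; rewrite inE.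
Qed.

Lemma proper_adj (G : sgraph) (chi : {ffun G -> 'I_3}) x y :
  proper_colouring chi -> adj x y -> chi x != chi y.
Proof. by move=> /forallP /(_ x) /forallP /(_ y) /implyP. Qed.

(** Here [a] and [b] stand for the neighbours that become decided in the two branches and [p], [q]
    for what stays undecided: as [a + b >= 2 k], one branch decides at least [k + 1] vertices. *)
Lemma branch_gain (k r p q m a b : nat) :
  (k + k <= r)%N -> (p + a.+1 <= m)%N -> (q + b.+1 <= m)%N -> (r <= a + b)%N ->
  (p + k.+1 <= m)%N || (q + k.+1 <= m)%N.
Proof. by case: (leqP k a) => ka ? ? ? ?; apply/orP; [left|right]; lia. Qed.

Section Lists.
Variable G : sgraph.
Implicit Types (L : {ffun G -> {set 'I_3}}) (F : {set {ffun G -> 'I_3}}).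
Implicit Types (chi : {ffun G -> 'I_3}).

Definition list_colourings F L := [set chi in F | [forall v, chi v \in L v]].

Lemma list_colouringsP F L chi :
  reflect (chi \in F /\ forall v, chi v \in L v) (chi \in list_colourings F L).
Proof. by rewrite inE; apply: (iffP andP) => -[? /forallP]. Qed.

Definition undecided L : {set G} := [set v | #|L v| == 2].

(** The states where the branching stops: no list is empty, no decided colour remains to be
    propagated, and no undecided vertex has enough undecided neighbours to be worth a branch. *)
Definition terminal (r : nat) L : Prop :=
  [/\ forall v, (0 < #|L v| <= 2)%N,
      forall u v, adj u v -> #|L v| = 1%N -> [disjoint L u & L v] &
      forall v, v \in undecided L -> (#|neighbours v :&: undecided L| < r)%N].

Definition assign L (v : G) (a : 'I_3) : {ffun G -> {set 'I_3}} :=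
  [ffun w => if w == v then [set a] else if adj v w then L w :\ a else L w].

Definition forbid L (v : G) (a : 'I_3) : {ffun G -> {set 'I_3}} :=
  [ffun w => if w == v then L w :\ a else L w].

Section Branching.
Variables (F : {set {ffun G -> 'I_3}}).
Hypothesis Fproper : {in F, forall chi, proper_colouring chi}.

Lemma list_colourings_assign L v chi :
  chi \in list_colourings F L -> chi \in list_colourings F (assign L v (chi v)).
Proof.
case/list_colouringsP => chiF chiL; apply/list_colouringsP; split => // w.
rewrite ffunE; have [->|wv] := eqVneq w v; first by rewrite inE.
case: (boolP (adj v w)) => // vw.
by rewrite !inE chiL andbT eq_sym; apply: proper_adj vw; apply: Fproper.
Qed.

Lemma card_assign L v a w : (forall w, #|L w| <= 2)%N -> v \in undecided L ->
  (#|assign L v a w| <= #|L w|)%N.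
Proof.
move=> L2; rewrite inE => /eqP Lv; rewrite ffunE; case: eqP => [->|_].
  by rewrite cards1 Lv.
by case: ifP => // _; rewrite subset_leq_card ?subD1set.
Qed.

(** Lists only shrink, so no vertex becomes undecided; [v] itself and its undecided neighbours
    listing [a] become decided. *)
Lemma undecided_assign L v a : (forall w, #|L w| <= 2)%N -> v \in undecided L ->
  (#|undecided (assign L v a)|
   + #|[set u in neighbours v :&: undecided L | a \in L u]|.+1 <= #|undecided L|)%N.
Proof.
move=> L2 vL; set U := [set u in _ | _].
have vU : v \notin U by rewrite !inE adj_irrefl.
have sub : v |: U \subset undecided L.
  by apply/subsetP => w; rewrite !inE => /orP [/eqP ->|/andP [/andP []] //]; rewrite inE in vL.
rewrite -(cardsID (v |: U) (undecided L)) (setIidPr sub) cardsU1 vU addnC leq_add2l.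
apply: subset_leq_card; apply/subsetP => w; rewrite inE => wa.
have wL : w \in undecided L.
  rewrite inE eqn_leq L2 /=; move: wa => /eqP <-; exact: card_assign.
rewrite in_setD wL andbT; apply/negP; rewrite !inE => /orP [/eqP wv|].
  by move: wa; rewrite ffunE wv eqxx cards1.
case/andP => /andP [vw _] aL; move: wa; rewrite ffunE vw.
case: (w =P v) => [_|_ wa]; first by rewrite cards1.
by move: wL wa; rewrite inE (cardsD1 a) aL add1n => /eqP [->].
Qed.

Variables (R : realType) (B x : R) (r k : nat).
Hypotheses (x_ge1 : 1 <= x) (xk : 1 <= x ^+ k * (x - 1)) (kr : (k.*2 <= r)%N).
Hypothesis B_ge0 : 0 <= B.
Hypothesis bound_terminal : forall L, terminal r L -> #|list_colourings F L|%:R <= B.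

(** The hypothesis [xk] says [x ^+ k + 1 <= x ^+ k.+1], the characteristic inequality of a branching
    that removes [k + 1] vertices on one branch and one on the other. *)
Lemma branching_step (p q m : nat) :
  (p < m)%N -> (q < m)%N -> (p + k.+1 <= m)%N || (q + k.+1 <= m)%N ->
  x ^+ p + x ^+ q <= x ^+ m.
Proof.
wlog pk : p q / (p + k.+1 <= m)%N.
  move=> H pm qm /orP [pk|qk]; first by apply: H => //; rewrite pk.
  by rewrite addrC; apply: H => //; rewrite qk.
move=> _ qm _; have -> : m = ((m - k.+1) + k.+1)%N by lia.
apply: le_trans (lerD (ler_weXn2l x_ge1 (_ : (p <= m - k.+1)%N))
  (ler_weXn2l x_ge1 (_ : (q <= m - k.+1 + k)%N))) _; [lia..|].
have : 1 <= x ^+ (m - k.+1) by rewrite exprn_ege1.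
rewrite !exprD exprS; move: (x ^+ (m - k.+1)) (x ^+ k) xk => y X h y1.
have : 0 <= y * (X * (x - 1) - 1) by rewrite mulr_ge0 //; lra.
lra.
Qed.

(** Induction on the total size of the lists, which drops even when a propagation leaves the number
    of undecided vertices unchanged. *)
Lemma branching_bound L : (forall v, #|L v| <= 2)%N ->
  #|list_colourings F L|%:R <= B * x ^+ #|undecided L|.
Proof.
have [s] := ubnP (\sum_v #|L v|)%N; elim: s L => // s IH L sL L2.
have x_ge0 : 0 <= x := le_trans ler01 x_ge1.
have [/existsP [v /eqP Lv]|ne] := boolP [exists v, L v == set0].
  rewrite (_ : list_colourings F L = set0) ?cards0 ?mulr_ge0 ?exprn_ge0 //.
  apply/setP => chi; rewrite in_set0; apply/negP => /list_colouringsP [_ /(_ v)].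
  by rewrite Lv inE.
(* Propagation: [v] is decided with a colour [c] still listed at its neighbour [u]; deleting [c]
   there loses no proper colouring. *)
have [/existsP [u /existsP [v /andP [/andP [uv /cards1P [c Lv]] cLu]]]|stable] :=
  boolP [exists u, exists v, (adj u v && (#|L v| == 1%N)) && ~~ [disjoint L u & L v]].
  have {}cLu : c \in L u.
    move: cLu; rewrite -setI_eq0 => /set0Pn [b]; rewrite Lv !inE => /andP [bL /eqP bc].
    by rewrite -bc.
  have sub w : (#|forbid L u c w| <= #|L w|)%N.
    by rewrite ffunE; case: ifP => // _; rewrite subset_leq_card ?subD1set.
  have -> : list_colourings F L = list_colourings F (forbid L u c).
    apply/setP => chi; apply/list_colouringsP/list_colouringsP => -[chiF chiL]; split=> // w.
      rewrite ffunE; case: eqP => // ->; rewrite !inE chiL andbT.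
      have := chiL v; rewrite Lv inE => /eqP <-; apply: proper_adj uv.
      exact: Fproper.
    by have := chiL w; rewrite ffunE; case: ifP => // _; rewrite inE => /andP [].
  apply: le_trans (IH _ _ _) _.
  - apply: leq_trans (_ : \sum_w #|L w| <= s)%N; last by rewrite -ltnS.
    rewrite (bigD1 u) //= [X in (_ < X)%N](bigD1 u) //= -addSn leq_add //.
      by rewrite ffunE eqxx [X in (_ < X)%N](cardsD1 c) cLu.
    exact: leq_sum.
  - by move=> w; apply: leq_trans (sub w) (L2 w).
  rewrite ler_wpM2l // ler_weXn2l // subset_leq_card //; apply/subsetP => w.
  rewrite !inE => /eqP h; rewrite eqn_leq L2 /=.
  by rewrite -h sub.
have [/existsP [v /andP [vL rv]]|low] :=
  boolP [exists v, (v \in undecided L) && (r <= #|neighbours v :&: undecided L|)%N]; last first.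
  have tL : terminal r L.
    split.
    - move=> v; rewrite L2 andbT card_gt0; apply: contra ne => h.
      by apply/existsP; exists v.
    - move=> u v uv /eqP Lv; apply: contraR stable => h.
      by apply/existsP; exists u; apply/existsP; exists v; rewrite uv Lv.
    - move=> v vL; rewrite ltnNge; apply: contra low => h.
      by apply/existsP; exists v; rewrite vL.
  apply: le_trans (bound_terminal tL) _; rewrite ler_peMr //; exact: exprn_ege1.
have /cards2P [a [b [ab Lv]]] : #|L v| == 2 by move: vL; rewrite inE.
have child c : (\sum_w #|assign L v c w| < s)%N.
  apply: leq_trans (_ : \sum_w #|L w| <= s)%N; last by rewrite -ltnS.
  rewrite (bigD1 v) //= [X in (_ < X)%N](bigD1 v) //= -addSn leq_add //.
    by rewrite ffunE eqxx cards1; move: vL; rewrite inE => /eqP ->.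
  by apply: leq_sum => w _; apply: card_assign.
have child2 c w : (#|assign L v c w| <= 2)%N.
  by apply: leq_trans (card_assign c w L2 vL) (L2 w).
have sub : list_colourings F L \subset
    list_colourings F (assign L v a) :|: list_colourings F (assign L v b).
  apply/subsetP => chi chiL; rewrite in_setU.
  have /list_colouringsP [_ /(_ v)] := chiL; rewrite Lv in_set2.
  by case/orP => /eqP <-; rewrite list_colourings_assign // orbT.
have : (#|list_colourings F L| <= #|list_colourings F (assign L v a)|
        + #|list_colourings F (assign L v b)|)%N.
  exact: leq_trans (subset_leq_card sub) (leq_card_setU _ _).
rewrite -(ler_nat R) natrD => /le_trans; apply.
apply: le_trans (lerD (IH _ (child a) (child2 a)) (IH _ (child b) (child2 b))) _.
rewrite -mulrDr ler_wpM2l //.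
have fa := undecided_assign a L2 vL; have fb := undecided_assign b L2 vL.
apply: branching_step; [by move: fa; clear; lia | by move: fb; clear; lia |].
(* An undecided vertex misses only one colour, so its list contains [a] or [b]. *)
suff : (r <= #|[set u in neighbours v :&: undecided L | a \in L u]|
          + #|[set u in neighbours v :&: undecided L | b \in L u]|)%N.
  by move: kr fa fb; rewrite -addnn; apply: branch_gain.
apply: leq_trans rv (leq_trans _ (leq_card_setU _ _)).
apply: subset_leq_card; apply/subsetP => u; rewrite !inE => /andP [-> Lu] /=.
rewrite Lu /= -[_ || _]negbK negb_or; apply/negP => /andP [aL bL].
have sub2 : [set a; b] \subset ~: L u.
  by apply/subsetP => c; rewrite !inE => /orP [] /eqP ->.
by have := subset_leq_card sub2; rewrite cards2 ab cardsCs setCK (eqP Lu) card_ord.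
Qed.
End Branching.
End Lists.

(** * Matchings between undecided vertices *)

Section Matching.
Variable G : sgraph.

(** The two sets may coincide; uniqueness of the concatenated endpoint lists still makes the edges
    pairwise disjoint. *)
Definition matching (X Y : {set G}) (s : seq (G * G)) : Prop :=
  uniq (unzip1 s ++ unzip2 s) /\
  {in s, forall e, [/\ e.1 \in X, e.2 \in Y & adj e.1 e.2]}.

Lemma maximal_matching (X Y : {set G}) : [disjoint X & Y] ->
  exists2 s, matching X Y s &
    forall v u, v \in X -> u \in Y -> adj v u ->
      (v \in unzip1 s) || (u \in unzip2 s).
Proof.
have [m] := ubnP #|X|; elim: m X Y => // m IH X Y mX dXY.
have [/existsP [v /existsP [u /and3P [vX uY vu]]]|no] :=
  boolP [exists v, exists u, [&& v \in X, u \in Y & adj v u]]; last first.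
  exists [::] => // v u vX uY vu; case/negP: no.
  by apply/existsP; exists v; apply/existsP; exists u; rewrite vX uY.
have X'X : X :\ v \subset X := subD1set _ _.
have Y'Y : Y :\ u \subset Y := subD1set _ _.
have [|| s [us sXY] cov] := IH (X :\ v) (Y :\ u).
- by move: mX; rewrite (cardsD1 v X) vX.
- exact: disjointW X'X Y'Y dXY.
have s1 w : w \in unzip1 s -> w \in X :\ v by case/mapP => e /sXY [? _ _] ->.
have s2 w : w \in unzip2 s -> w \in Y :\ u by case/mapP => e /sXY [_ ? _] ->.
exists ((v, u) :: s).
  split=> [|e].
    rewrite /= mem_cat negb_or; apply/andP; split.
      apply/andP; split; first by apply/negP => /s1; rewrite !inE eqxx.
      rewrite inE negb_or; apply/andP; split.
        by apply/eqP => vu'; move: vu; rewrite vu' adj_irrefl.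
      by apply/negP => /s2; rewrite !inE (disjointFr dXY vX) andbF.
    rewrite uniq_catC /= uniq_catC us andbT mem_cat negb_or; apply/andP; split.
      by apply/negP => /s2; rewrite !inE eqxx.
    by apply/negP => /s1; rewrite !inE (disjointFl dXY uY) andbF.
  rewrite inE => /orP [/eqP -> //|/sXY []].
  by rewrite !inE => /andP [_ ->] /andP [_ ->].
move=> v' u' v'X u'Y v'u'; rewrite /= !inE.
have [//|nv] := eqVneq v' v; have [|nu] := eqVneq u' u; first by rewrite orbT.
by apply: cov => //; rewrite !inE ?nv ?nu.
Qed.

Variables (F : {set {ffun G -> 'I_3}}).
Hypothesis Fproper : {in F, forall chi, proper_colouring chi}.
Implicit Types (L : {ffun G -> {set 'I_3}}) (s : seq (G * G)).

Lemma card_list_colourings L : (forall v, #|L v| <= 2)%N ->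
  (#|list_colourings F L| <= 2 ^ #|undecided L|)%N.
Proof.
move=> L2; pose Fam := family (fun v : G => mem (L v)).
apply: leq_trans (_ : #|Fam| <= _)%N.
  apply: subset_leq_card; apply/subsetP => chi /list_colouringsP [_ chiL].
  by apply/familyP => v; apply: chiL.
rewrite card_family foldrE big_map big_enum /=.
rewrite -prod_nat_const [X in (_ <= X)%N]big_mkcond /=.
apply: leq_prod => v _; rewrite inE; case: eqP => [/eqP /eqP -> //|].
by have := L2 v; case: #|L v| => [|[|[|]]].
Qed.

(** Two 2-element lists over three colours share a colour, so at most 3 of the 4 pairs are proper on
    a matched edge. Fixing the pair decides both ends, and the other edges are handled
    inductively. *)
Lemma matching_bound L s : (forall v, #|L v| <= 2)%N ->
  matching (undecided L) (undecided L) s ->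
  (#|list_colourings F L| * 4 ^ size s <= 3 ^ size s * 2 ^ #|undecided L|)%N.
Proof.
elim: s L => [|[v u] s IH] L L2 [us sL].
  by rewrite !expn0 muln1 mul1n card_list_colourings.
have [/= vL uL vu] := sL (v, u) (mem_head _ _).
have nvu : u != v by apply/eqP => uv; move: vu; rewrite uv adj_irrefl.
pose L' (c : 'I_3 * 'I_3) : {ffun G -> {set 'I_3}} :=
  [ffun w => if w == v then [set c.1] else if w == u then [set c.2] else L w].
have L'2 c w : (#|L' c w| <= 2)%N.
  by rewrite ffunE; case: eqP => _; [|case: eqP => _]; rewrite ?cards1.
have undecided' c : undecided L = v |: (u |: undecided (L' c)).
  apply/setP => w; rewrite !inE ffunE; case: (w =P v) => [->|_] /=.
    by move: vL; rewrite inE.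
  by case: (w =P u) => [->|_] //=; move: uL; rewrite inE.
have card_free c : #|undecided L| = (#|undecided (L' c)|.+2)%N.
  rewrite (undecided' c) !cardsU1 !inE !ffunE eqxx cards1 (negPf nvu) eqxx.
  by rewrite cards1 orbF eq_sym nvu.
pose C := [set c : 'I_3 * 'I_3 | [&& c.1 \in L v, c.2 \in L u & c.1 != c.2]].
have C3 : (#|C| <= 3)%N.
  have [b] : exists b, b \in L v :&: L u.
    apply/set0Pn; rewrite setI_eq0; apply/negP => dis.
    have := max_card (mem (L v :|: L u)); rewrite card_ord.
    have [_] := leq_card_setU (L v) (L u); rewrite dis => /eqP ->.
    by move: vL uL; rewrite !inE => /eqP -> /eqP ->.
  rewrite inE => /andP [bv bu].
  have sub : (b, b) |: C \subset setX (L v) (L u).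
    apply/subsetP => -[c1 c2]; rewrite !inE /= => /orP [/eqP [-> ->]|/and3P [-> -> //]].
    by rewrite bv.
  have := subset_leq_card sub; rewrite cardsU1 cardsX !inE /= bv bu eqxx /=.
  by move: vL uL; rewrite !inE => /eqP -> /eqP ->.
set K := (3 ^ size s * 2 ^ #|undecided L|.-2 %/ 4 ^ size s)%N.
have fibres : (#|list_colourings F L| <= #|C| * K)%N.
  apply: (card_le_fibers (f := fun chi : {ffun G -> 'I_3} => (chi v, chi u))).
    move=> chi /list_colouringsP [chiF chiL]; rewrite inE /= !chiL /=.
    by apply: proper_adj vu; apply: Fproper.
  move=> c cC; rewrite leq_divRL ?expn_gt0 //.
  have -> : #|undecided L|.-2 = #|undecided (L' c)| by rewrite (card_free c).
  apply: leq_trans (IH (L' c) (L'2 c) _).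
    rewrite leq_mul2r; apply/orP; right; apply: subset_leq_card.
    apply/subsetP => chi; rewrite inE => /andP [/list_colouringsP [chiF chiL] /eqP cE].
    apply/list_colouringsP; split=> // w; rewrite ffunE -cE /=.
    by case: eqP => [->|_]; [|case: eqP => [->|_]]; rewrite ?inE.
  split=> [|e es].
    by move: us; rewrite /= => /andP [_]; rewrite uniq_catC /= => /andP [_]; rewrite uniq_catC.
  have [e1 e2 e12] : [/\ e.1 \in undecided L, e.2 \in undecided L & adj e.1 e.2].
    by apply: sL; rewrite inE es orbT.
  move: us; rewrite /= mem_cat inE !negb_or => /andP [/and3P [v1 _ v2]].
  rewrite uniq_catC /= mem_cat negb_or => /andP [/andP [u2 u1] _].
  have s1 := map_f fst es; have s2 := map_f snd es.
  have ne w : w \in undecided L -> w != v -> w != u -> w \in undecided (L' c).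
    by rewrite (undecided' c) => /setU1P [->|/setU1P [->|//]]; rewrite eqxx.
  have mem_ne (S : seq G) w z : w \in S -> z \notin S -> w != z.
    by move=> wS; apply: contraNneq => <-.
  split=> //; apply: ne => //.
  - exact: mem_ne s1 v1.
  - exact: mem_ne s1 u1.
  - exact: mem_ne s2 v2.
  - exact: mem_ne s2 u2.
have KE : (K * 4 ^ size s <= 3 ^ size s * 2 ^ #|undecided L|.-2)%N by apply: leq_divM.
have -> : (2 ^ #|undecided L| = 4 * 2 ^ #|undecided L|.-2)%N.
  by rewrite (card_free (ord0, ord0)) /= !expnS mulnA.
have CK : (#|C| * K <= 3 * K)%N by rewrite leq_mul2r C3 orbT.
rewrite /= !expnS; move: (leq_trans fibres CK) KE.
move: (#|list_colourings F L|) (4 ^ size s)%N (3 ^ size s)%N (2 ^ _)%N => a b c e; nia.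
Qed.
End Matching.

(** * The structure of terminal list assignments *)

Lemma sum_card_classes (X Y : finType) (A : {set X}) (g : X -> Y) :
  (\sum_i #|[set v in A | g v == i]| = #|A|)%N.
Proof.
rewrite -[RHS]sum1_card (partition_big g predT) //=; apply: eq_bigr => i _.
by rewrite -sum1_card; apply: eq_bigl => v; rewrite inE.
Qed.

Section Terminal.
Variables (R : realType) (G : sgraph) (d r : nat) (delta : R).
Hypotheses (d_gt0 : (0 < d)%N) (dreg : regular G d) (delta_ge0 : 0 <= delta).
Variable L : {ffun G -> {set 'I_3}}.
Hypothesis termL : terminal r L.

Let U := undecided L.

(** Meaningful on undecided vertices only, as [decided] is on the others: see [undecided_missing]
    and [decidedP]. *)
Definition missing (v : G) : 'I_3 := odflt ord0 [pick i | i \notin L v].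
Definition decided (v : G) : 'I_3 := odflt ord0 [pick i in L v].

Lemma undecided_missing v : v \in U -> L v = ~: [set missing v].
Proof.
rewrite inE => /eqP Lv; apply/eqP; rewrite eqEcard cardsC1 card_ord Lv leqnn andbT.
rewrite subsetC sub1set inE /missing; case: pickP => //= all_in.
have : L v = setT by apply/setP => i; rewrite inE; have := all_in i; case: (i \in L v).
by move/(congr1 (fun A : {set 'I_3} => #|A|)); rewrite Lv cardsT card_ord.
Qed.

Lemma decidedP v : v \notin U -> L v = [set decided v].
Proof.
case: termL => /(_ v) L12 _ _; rewrite inE => Lv.
have /eqP/cards1P [c Lc] : #|L v| = 1%N by move: L12 Lv; case: #|L v| => [|[|[|]]].
rewrite Lc /decided Lc; case: pickP => [i|/(_ c)]; rewrite inE ?eqxx //.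
by move=> /eqP ->.
Qed.

Section Side.
Variables (E O ZE ZO : {set G}) (mu : nat).
Hypotheses (bip : bipartition E O) (dmin : is_bip_expansion E O delta).
Hypotheses (ZEmu : (#|ZE| <= mu)%N) (ZOmu : (#|ZO| <= mu)%N).
Hypothesis cover : forall v u, v \in U :&: E -> u \in U :&: O -> adj v u ->
  (v \in ZE) || (u \in ZO).

(** Edges from [U :&: E] to decided vertices number at most [d * #|O :\: U|]. Each remaining one is
    charged to an end in [ZE] or [ZO], and such a vertex has fewer than [r] undecided neighbours. *)
Lemma undecided_edges :
  (d * #|U :&: E| <= d * #|O :\: U| + (2 * r) * mu)%N.
Proof.
case: termL => _ _ low.
have NE : neighbourhood (U :&: E) \subset O.
  exact/(neighbourhood_side bip)/subsetIr.
rewrite -(edge_count_neighbourhood dreg NE).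
apply: leq_trans (_ : \sum_(x in U :&: E)
   (#|neighbours x :&: (O :\: U)| + #|neighbours x :&: (U :&: O)|) <= _)%N.
  apply: leq_sum => x _; rewrite -(cardsID U (neighbours x :&: O)) addnC.
  by rewrite -setIDA -setIA [O :&: U]setIC.
rewrite big_split /= leq_add //; first by rewrite edge_count_sym edge_count_le.
apply: leq_trans (_ : \sum_(x in U :&: E) (\sum_(y in neighbours x :&: (U :&: O))
    ((x \in ZE) + (y \in ZO))) <= _)%N.
  apply: leq_sum => x xUE; rewrite -sum1_card; apply: leq_sum => y.
  rewrite in_setI in_neighbours => /andP [xy yUO].
  by have := cover xUE yUO xy; case: (x \in ZE); case: (y \in ZO).
under eq_bigr do rewrite big_split /=.
rewrite big_split /= -mulnA mul2n -addnn leq_add //.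
  rewrite (bigID (mem ZE)) /= [X in (_ + X)%N]big1 ?addn0; last first.
    by move=> x /andP [_ /negPf xZ]; rewrite big1 // => y _; rewrite xZ.
  apply: leq_trans (_ : \sum_(x in ZE) r <= _)%N; last first.
    by rewrite sum_nat_const mulnC leq_mul2l ZEmu orbT.
  rewrite big_mkcond [X in (_ <= X)%N]big_mkcond; apply: leq_sum => x _ /=.
  case: (x \in ZE); rewrite ?andbF // andbT.
  case: ifP => // /setIP [xU _]; rewrite sum_nat_const muln1.
  apply: leq_trans (ltnW (low x xU)); apply: subset_leq_card.
  by apply: setIS; apply: subsetIl.
rewrite (exchange_big_dep (fun y => y \in U :&: O)) /=; last first.
  by move=> x y _; rewrite in_setI => /andP [].
apply: leq_trans (_ : \sum_(y in ZO) r <= _)%N; last first.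
  by rewrite sum_nat_const mulnC leq_mul2l ZOmu orbT.
rewrite big_mkcond [X in (_ <= X)%N]big_mkcond; apply: leq_sum => y _ /=.
case: ifP => // yUO; rewrite sum_nat_const.
case: (y \in ZO); rewrite ?muln0 // muln1.
have /setIP [yU _] := yUO.
apply: leq_trans (ltnW (low y yU)); apply: subset_leq_card.
apply/subsetP => x; rewrite unfold_in /= => /andP [/setIP [xU _] /setIP [xy _]].
by rewrite in_setI xU andbT neighboursC.
Qed.

Definition missing_class (i : 'I_3) : {set G} :=
  [set v in (U :&: E) :\: ZE | missing v == i].
Definition decided_class (i : 'I_3) : {set G} :=
  [set u in O :\: U | decided u == i].

(** An undecided neighbour must lie in [ZO] by [cover]; a decided one has a colour outside the list
    of [v] by stability, that is, the missing colour [i]. *)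
Lemma neighbourhood_missing_class i :
  neighbourhood (missing_class i) \subset decided_class i :|: ZO.
Proof.
case: termL => _ stable _.
apply/subsetP => u /in_neighbourhood [v]; rewrite inE => /andP [].
rewrite in_setD => /andP [vZ vUE] /eqP mv vu; have /setIP [vU vE] := vUE.
have uO : u \in O by rewrite -(adj_bipartition bip vu).
have [uU|uU] := boolP (u \in U).
  have := cover vUE (_ : u \in U :&: O) vu; rewrite !in_setI uU uO (negPf vZ) => /(_ isT) /= uZ.
  by rewrite in_setU uZ orbT.
rewrite in_setU inE in_setD uU uO /=; apply/orP; left.
have := stable v u vu; rewrite (decidedP uU) cards1 => /(_ erefl).
by rewrite disjoint_sym disjoints1 (undecided_missing vU) mv !inE negbK.
Qed.

Lemma card_missing_classes :
  (#|U :&: E| <= \sum_i #|missing_class i| + mu)%N.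
Proof.
rewrite sum_card_classes; apply: leq_trans (leq_add (leqnn _) ZEmu).
rewrite -(cardsID ZE (U :&: E)) addnC leq_add2l; exact/subset_leq_card/subsetIr.
Qed.

Lemma card_neighbourhood_missing_class i :
  (#|neighbourhood (missing_class i)| <= #|decided_class i| + mu)%N.
Proof.
apply: leq_trans (subset_leq_card (neighbourhood_missing_class i)) _.
by apply: leq_trans (leq_card_setU _ _) _; rewrite leq_add2l.
Qed.

(** All three classes have a nonnegative gap between neighbourhood and class, so the gap of one is
    at most the total. Three [mu] come from the neighbourhoods and one from the removed set [ZE]. *)
Lemma missing_class_gap i :
  (#|neighbourhood (missing_class i)| + #|U :&: E|
     <= #|missing_class i| + #|O :\: U| + 4 * mu)%N.
Proof.
have h j : (#|missing_class j| <= #|neighbourhood (missing_class j)|)%N.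
  by apply: (card_neighbourhood_ge dreg d_gt0).
have tot : (\sum_j #|neighbourhood (missing_class j)| <= #|O :\: U| + 3 * mu)%N.
  apply: leq_trans (leq_sum _ (fun j _ => card_neighbourhood_missing_class j)) _.
  by rewrite big_split /= sum_card_classes sum_nat_const card_ord.
have := card_missing_classes.
have : (#|neighbourhood (missing_class i)| + \sum_j #|missing_class j|
     <= #|missing_class i| + \sum_j #|neighbourhood (missing_class j)|)%N.
  rewrite (bigD1 i) //= [X in (_ <= _ + X)%N](bigD1 i) //= addnCA leq_add2l leq_add2l.
  exact: leq_sum.
move: tot; lia.
Qed.

(** By [expansion_dichotomy], a class larger than [c] can have so small a gap only if its
    neighbourhood misses fewer than [c] vertices of [O]; then colour [i] is forced on nearly all of
    [O]. Otherwise all three classes have size at most [c]. *)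
Lemma side_alternative (c : R) : 0 < c ->
  #|O :\: U|%:R - #|U :&: E|%:R + 4 * mu%:R < delta * c ->
  (exists i, #|O|%:R - c - mu%:R < #|decided_class i|%:R :> R) \/
  #|U :&: E|%:R <= 3 * c + mu%:R.
Proof.
move=> c_gt0 gap.
have alt i : #|missing_class i|%:R <= c \/ #|O|%:R - c - mu%:R < #|decided_class i|%:R :> R.
  have [//|big] := lerP (#|missing_class i|%:R) c; [by left | right].
  have := card_neighbourhood_missing_class i.
  rewrite -(ler_nat R) natrD => N_le.
  have := missing_class_gap i; rewrite -(ler_nat R) !natrD => gap_i.
  have SE : missing_class i \subset E.
    by apply/subsetP => v; rewrite inE in_setD in_setI => /andP [/and3P []].
  have [h|h] := expansion_dichotomy d_gt0 dreg bip dmin delta_ge0 SE.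
    have : delta * c <= delta * #|missing_class i|%:R by rewrite ler_wpM2l // ltW.
    by move=> ?; lra.
  have [//|small] := ltrP (#|O|%:R - c - mu%:R) (#|decided_class i|%:R : R).
  have : delta * c <= delta * (#|O|%:R - #|neighbourhood (missing_class i)|%:R).
    by rewrite ler_wpM2l //; lra.
  by move=> ?; lra.
have [/existsP [i di]|no] :=
  boolP [exists i, #|O|%:R - c - mu%:R < #|decided_class i|%:R :> R].
  by left; exists i.
right; have := card_missing_classes; rewrite -(ler_nat R) natrD natr_sum.
move/le_trans; apply; rewrite lerD2r.
apply: le_trans (_ : \sum_(i : 'I_3) c <= _).
  apply: ler_sum => i _; case: (alt i) => // di; case/negP: no.
  by apply/existsP; exists i.
by rewrite sumr_const card_ord mulr_natl.
Qed.

End Side.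
End Terminal.

(** * Counting undominated colourings at a terminal assignment *)

Section Dominance.
Variables (R : realType) (G : sgraph).
Implicit Types (A : {set G}) (chi : {ffun G -> 'I_3}).

Definition colour_class chi A (i : 'I_3) : {set G} := [set v in A | chi v == i].

Definition dominated (eta : R) A chi : bool :=
  [exists i, (1 - eta) * #|A|%:R <= #|colour_class chi A i|%:R].

(** Fifth powers: 243/1024 is below 1/4. A matched edge thus saves 2/5 in the exponent, more than
    the 1/4 it may cost through [undecided_edges]. *)
Lemma three_quarters_le : 3 / 4 <= 2 `^ (- (2 / 5)) :> R.
Proof.
rewrite -(@ler_pXn2r _ 5) ?nnegrE ?powR_ge0 //; last by lra.
rewrite -[X in _ <= X]powR_mulrn ?powR_ge0 // -powRrM.
have -> : - (2 / 5) * 5%:R = - 2%:R :> R by lra.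
by rewrite powRN powR_mulrn //; lra.
Qed.

Variables (d r : nat) (delta eps : R) (E O : {set G}).
Hypotheses (d_gt0 : (0 < d)%N) (dreg : regular G d) (delta_ge0 : 0 <= delta).
Hypotheses (bip : bipartition E O) (dmin : is_bip_expansion E O delta).
Hypotheses (eps_gt0 : 0 < eps) (eps_le : eps <= 1 / 10) (rd : (8 * r <= d)%N).

Definition undominated_colourings : {set {ffun G -> 'I_3}} :=
  [set chi | [&& proper_colouring chi, ~~ dominated (2 * eps) E chi
               & ~~ dominated (2 * eps) O chi]].

(** If the bound fails, the matching estimate forces [#|U|] to be large while [undecided_edges] caps
    it. So [mu] is small, and both outcomes of [side_alternative] become impossible on the two
    sides. *)
Lemma terminal_bound L : terminal r L ->
  #|list_colourings undominated_colourings L|%:R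
    <= 2 `^ (#|E|%:R - delta * (eps * #|E|%:R) / 25).
Proof.
move=> termL; have [eEO cG] := card_bipartition d_gt0 dreg bip.
have dmin' := is_bip_expansionC dmin; have bip' := bipartitionC bip.
have n_gt0 : 0 < #|E|%:R :> R.
  by rewrite ltr0n (leq_trans d_gt0 (degree_le_side d_gt0 dreg bip dmin)).
have delta_le1 := bip_expansion_le1 d_gt0 dreg dmin.
set U := undecided L.
have dis : [disjoint U :&: E & U :&: O].
  by case: bip => _ dEO _; apply: disjointW dEO; apply: subsetIr.
have [s [us sUU] cov] := maximal_matching dis.
set mu := size s.
have UE : (#|U :&: E| + #|E :\: U| = #|E|)%N by rewrite setIC cardsID.
have UO : (#|U :&: O| + #|O :\: U| = #|O|)%N by rewrite setIC cardsID.
have Um : (#|U| = #|U :&: E| + #|U :&: O|)%N.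
  have EO : ~: E = O by apply/setP => v; rewrite inE (notin_bipartition bip).
  by rewrite -(cardsID E U) setDE EO.
have Fproper : {in undominated_colourings, forall chi, proper_colouring chi}.
  by move=> chi; rewrite inE => /and3P [].
have L2 v : (#|L v| <= 2)%N by case: termL => /(_ v) /andP [].
have match_le : (#|list_colourings undominated_colourings L| * 4 ^ mu
    <= 3 ^ mu * 2 ^ #|U|)%N.
  apply: matching_bound => //; split=> // e /sUU [].
  by rewrite !in_setI => /andP [-> _] /andP [-> _].
have {}match_le : #|list_colourings undominated_colourings L|%:R
    <= 2 `^ (#|U|%:R - 2 / 5 * mu%:R) :> R.
  move: match_le; rewrite -(ler_nat R) !natrM !natrX -ler_pdivlMr ?exprn_gt0 //.
  move/le_trans; apply; rewrite mulrAC -expr_div_n mulrC.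
  have two0 : (2 : R) != 0 by rewrite pnatr_eq0.
  rewrite powRD ?two0 ?implybT // powR_mulrn // ler_wpM2l ?exprn_ge0 //.
  rewrite -mulNr powRrM powR_mulrn ?powR_ge0 // lerXn2r ?nnegrE ?powR_ge0 ?three_quarters_le //.
  lra.
have ZEmu : (#|[set v in unzip1 s]| <= mu)%N.
  by rewrite cardsE (leq_trans (card_size _)) ?size_map.
have ZOmu : (#|[set v in unzip2 s]| <= mu)%N.
  by rewrite cardsE (leq_trans (card_size _)) ?size_map.
have covE v u : v \in U :&: E -> u \in U :&: O -> adj v u ->
    (v \in [set v in unzip1 s]) || (u \in [set v in unzip2 s]).
  by rewrite [v \in [set _ in _]]inE [u \in [set _ in _]]inE; apply: cov.
have covO v u : v \in U :&: O -> u \in U :&: E -> adj v u ->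
    (v \in [set v in unzip2 s]) || (u \in [set v in unzip1 s]).
  by move=> ? ? vu; rewrite orbC; apply: covE => //; rewrite adj_sym.
rewrite leNgt; apply/negP => big.
have U_big : #|E|%:R - delta * (eps * #|E|%:R) / 25 < #|U|%:R - 2 / 5 * mu%:R.
  rewrite ltNge; apply/negP => le; have := lt_le_trans big match_le.
  by rewrite ltNge ler_powR // ler1n.
have U_le : #|U|%:R <= #|E|%:R + mu%:R / 4 :> R.
  have := undecided_edges dreg termL bip ZEmu ZOmu covE.
  have : ((2 * r * mu) * 4 <= d * mu)%N by move: rd; clear; nia.
  rewrite -/U; move=> h1 h2.
  have h : (d * (4 * #|U|) <= d * (4 * #|E| + mu))%N.
    by rewrite Um eEO -UO; move: h1 h2; clear; nia.
  move: h; rewrite leq_pmul2l // -(ler_nat R) => h; lra.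
have kappa_le : delta * (eps * #|E|%:R) <= eps * #|E|%:R.
  by rewrite ler_piMl // mulr_ge0 // ltW.
have mu_ge0 : 0 <= mu%:R :> R by [].
have c_gt0 : 0 < eps * #|E|%:R by rewrite mulr_gt0.
have c_le : eps * #|E|%:R <= 1 / 10 * #|E|%:R by rewrite ler_wpM2r // ltW.
move: UE UO Um => /(congr1 (fun k => k%:R : R)) + /(congr1 (fun k => k%:R : R))
  + /(congr1 (fun k => k%:R : R)).
rewrite -eEO !natrD => UE UO Um.
(* Since [mu <= eps * #|E|], such a decided class makes every list colouring dominated, leaving none
   to count, contrary to [big]. *)
have no_dom A i : A = E \/ A = O ->
    #|A|%:R - eps * #|E|%:R - mu%:R < #|decided_class L A i|%:R :> R -> False.
  move=> AEO dom.
  have cA : #|A| = #|E| by case: AEO => ->.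
  suff L0 : list_colourings undominated_colourings L = set0.
    by move: big; rewrite L0 cards0 ltNge powR_ge0.
  apply/setP => chi; rewrite in_set0; apply/negP => /list_colouringsP [].
  rewrite inE => /and3P [_ /existsP nE /existsP nO] chiL.
  have domA : (1 - 2 * eps) * #|A|%:R <= #|colour_class chi A i|%:R.
    apply: le_trans (_ : #|decided_class L A i|%:R <= _).
      by apply: le_trans (ltW dom); rewrite cA; lra.
    rewrite ler_nat subset_leq_card //; apply/subsetP => u.
    rewrite inE in_setD => /andP [/andP [uU uA] /eqP di].
    rewrite inE uA /=; have := chiL u; rewrite (decidedP termL uU) di.
    by rewrite in_set1.
  by case: AEO => AE; [apply: nE | apply: nO]; exists i; rewrite -AE.
(* Put [K = delta * eps * #|E|]. From [U_big] and [U_le], [mu < 4 K / 15]; the left side is [#|E| -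
   #|U| + 4 mu < K / 25 + 18 mu / 5 < K]. This fixes the constant 25. *)
have gapE : #|O :\: U|%:R - #|U :&: E|%:R + 4 * mu%:R < delta * (eps * #|E|%:R) by lra.
have gapO : #|E :\: U|%:R - #|U :&: O|%:R + 4 * mu%:R < delta * (eps * #|E|%:R) by lra.
have := side_alternative d_gt0 dreg delta_ge0 termL bip dmin ZEmu ZOmu covE c_gt0 gapE.
case=> [[i]|aE]; first by apply: no_dom; right.
have := side_alternative d_gt0 dreg delta_ge0 termL bip' dmin' ZOmu ZEmu covO c_gt0 gapO.
case=> [[i]|aO]; first by apply: no_dom; left.
(* Now [#|U| <= 6 * eps * #|E| + 2 * mu], too small for [U_big] when [eps <= 1 / 10]. *)
have : #|E|%:R <= 0 :> R by rewrite -/U in aE aO; lra.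
by rewrite leNgt n_gt0.
Qed.

End Dominance.

(** * From a dominating set to all undominated colourings *)

Section Undominated.
Variables (R : realType) (G : sgraph) (d r k : nat) (delta eps x : R) (E O : {set G}).
Hypotheses (d_gt0 : (0 < d)%N) (dreg : regular G d) (delta_ge0 : 0 <= delta).
Hypotheses (bip : bipartition E O) (dmin : is_bip_expansion E O delta).
Hypotheses (eps_gt0 : 0 < eps) (eps_le : eps <= 1 / 10) (rd : (8 * r <= d)%N).
Hypotheses (x_ge1 : 1 <= x) (xk : 1 <= x ^+ k * (x - 1)) (kr : (k.*2 <= r)%N).
Variable T : {set G}.
Hypothesis domT : forall v, exists2 u, u \in T & adj v u.

(* Revealing the colours on a dominating set leaves at most two colours
   available at every vertex. *)
Lemma undominated_bound :
  #|undominated_colourings eps E O|%:R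
    <= 3 ^+ #|T| * (2 `^ (#|E|%:R - delta * (eps * #|E|%:R) / 25) * x ^+ #|G|).
Proof.
set F := undominated_colourings eps E O; set B := 2 `^ _.
have Fproper : {in F, forall chi, proper_colouring chi}.
  by move=> chi; rewrite inE => /and3P [].
have B_ge0 : 0 <= B := powR_ge0 _ _.
have x_ge0 : 0 <= x := le_trans ler01 x_ge1.
have K_ge0 : 0 <= B * x ^+ #|G| by rewrite mulr_ge0 ?exprn_ge0.
pose reveal (chi : {ffun G -> 'I_3}) : {ffun G -> 'I_3} :=
  [ffun v => if v \in T then chi v else ord0].
pose C : {set {ffun G -> 'I_3}} := [set t in pffun_on ord0 (mem T) predT].
have C3 : #|C| = (3 ^ #|T|)%N by rewrite cardsE card_pffun_on card_ord.
rewrite -natrX -C3; pose K := Num.truncn (B * x ^+ #|G|).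
apply: le_trans (_ : (#|C| * K)%N%:R <= _); last first.
  by rewrite natrM ler_wpM2l // truncn_le.
rewrite ler_nat; apply: (card_le_fibers (f := reveal)).
  move=> chi _; rewrite inE; apply/pffun_onP; split=> //; apply/subsetP => v.
  rewrite supportE ffunE.
  by case: (v \in T) => //; rewrite eqxx.
move=> t _; rewrite truncn_ge_nat //.
pose L : {ffun G -> {set 'I_3}} :=
  [ffun v => [set c | [forall u in T, adj v u ==> (c != t u)]]].
have L2 v : (#|L v| <= 2)%N.
  have [u uT vu] := domT v.
  apply: leq_trans (_ : #|~: [set t u]| <= _)%N; last by rewrite cardsC1 card_ord.
  apply: subset_leq_card; apply/subsetP => c; rewrite ffunE !inE.
  by move/forallP/(_ u)/implyP/(_ uT)/implyP/(_ vu).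
have := branching_bound Fproper x_ge1 xk kr B_ge0
  (terminal_bound d_gt0 dreg delta_ge0 bip dmin eps_gt0 eps_le rd) L2.
move=> bnd; apply: le_trans (_ : #|list_colourings F L|%:R <= _).
  rewrite ler_nat subset_leq_card //; apply/subsetP => chi.
  rewrite inE => /andP [chiF /eqP tE]; apply/list_colouringsP; split=> // v.
  rewrite ffunE inE; apply/forallP => u; apply/implyP => uT; apply/implyP => vu.
  by rewrite -tE ffunE uT; apply: proper_adj vu; apply: Fproper.
by apply: le_trans bnd _; rewrite ler_wpM2l // ler_weXn2l // max_card.
Qed.

End Undominated.

(** * Chernoff bounds for dominated colourings *)

Lemma card_small_subsets (R : realType) (T : finType) (X : {set T}) (y a : R) :
  0 < y -> y <= 1 ->
  #|[set A : {set T} | A \subset X & #|A|%:R <= a]|%:R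
    <= (1 + y) ^+ #|X| * y `^ (- a).
Proof.
move=> y_gt0 y_le1; set S := [set A | _].
rewrite powRN ler_pdivlMr ?powR_gt0 //.
(* Chernoff weights: every [A] in [S] has [y ^+ #|A|] at least [y] to the power [a], and all subsets
   of [X] together weigh [(1 + y) ^+ #|X|]. *)
apply: le_trans (_ : \sum_(A in S) y ^+ #|A| <= _).
  rewrite mulr_natl -sumr_const; apply: ler_sum => A; rewrite inE => /andP [_ cA].
  rewrite -powR_mulrn ?(ltW y_gt0) //; apply: ger_powR => //; exact/andP.
have -> : (1 + y) ^+ #|X| = \prod_(i : T) ((if i \in X then y else 0) + 1).
  rewrite -prodr_const big_mkcond /=; apply: eq_bigr => i _.
  by case: (i \in X); rewrite ?add0r // addrC.
rewrite bigA_distr; apply: le_trans (_ : \sum_(A in S)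
    \prod_i (if i \in A then if i \in X then y else 0 else 1) <= _).
  apply: ler_sum => A; rewrite inE => /andP [/subsetP AX _].
  rewrite -prodr_const big_mkcond /=; apply: ler_prod => i _.
  by case: (boolP (i \in A)) => [/AX -> | _]; rewrite lexx ?ltW.
rewrite big_mkcond; apply: ler_sum => A _; case: (A \in S) => //.
apply: prodr_ge0 => i _; case: (i \in A) => //; case: (i \in X) => //; exact: ltW.
Qed.

Lemma third_colour (a b c i : 'I_3) :
  i != c -> a != i -> b != i -> (a == c) = (b == c) -> a = b.
Proof.
case: a b c i => [a la] [b lb] [c lc] [i li]; rewrite -!val_eqE /=.
by move=> *; apply: val_inj => /=; lia.
Qed.

Section Phases.
Variables (R : realType) (G : sgraph) (d : nat).
Hypotheses (d_gt0 : (0 < d)%N) (dreg : regular G d).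

(** The neighbours of the [X]-vertices coloured [c] are [Y]-vertices not coloured [c], and there are
    at least as many of them. *)
Lemma colour_class_le (X Y : {set G}) (chi : {ffun G -> 'I_3}) (c : 'I_3) :
  bipartition X Y -> proper_colouring chi ->
  (#|colour_class chi X c| + #|colour_class chi Y c| <= #|Y|)%N.
Proof.
move=> bip pchi.
have cY : colour_class chi Y c \subset Y by apply/subsetP => v; rewrite inE => /andP [].
rewrite -(cardsID (colour_class chi Y c) Y) (setIidPr cY) addnC leq_add2l.
apply: (card_neighbourhood_ge dreg d_gt0); apply/subsetP => u.
case/in_neighbourhood => v; rewrite inE => /andP [vX /eqP cv] vu.
rewrite !inE -(adj_bipartition bip vu) vX /= andbT -cv eq_sym.
exact: proper_adj vu.
Qed.

Section OnePhase.
Variables (X Y : {set G}) (i c : 'I_3) (eta alpha : R).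
Hypotheses (bip : bipartition X Y) (ic : i != c).

Definition phase : {set {ffun G -> 'I_3}} :=
  [set chi | [&& proper_colouring chi,
    (1 - eta) * #|Y|%:R <= #|colour_class chi Y i|%:R &
    #|colour_class chi X c|%:R <= alpha * #|Y|%:R]].

(* A colouring in [phase] is recovered from the set of vertices of [X]
   coloured [c], the set [W] of vertices of [Y] not coloured [i], and its
   values on [W] and on the vertices that have no neighbour outside [W]. *)
Lemma card_phase_fiber (A W : {set G}) :
  (#|[set chi in phase | (colour_class chi X c, Y :\: colour_class chi Y i) == (A, W)]|
     <= 3 ^ (2 * #|W|))%N.
Proof.
set S := [set chi in _ | _].
pose K := W :|: [set v in X | neighbours v \subset W].
(* Vertices with all neighbours in [W] are at most [#|W|] in number, by edge counting. *)
have cK : (#|K| <= 2 * #|W|)%N.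
  apply: leq_trans (leq_card_setU _ _) _; rewrite mul2n -addnn leq_add2l.
  apply: (card_neighbourhood_ge dreg d_gt0); apply/subsetP => u.
  case/in_neighbourhood => v; rewrite inE => /andP [_ /subsetP NW] vu.
  by apply: NW; rewrite in_neighbours.
apply: leq_trans (_ : 3 ^ #|K| <= _)%N; last by rewrite leq_exp2l.
pose g (chi : {ffun G -> 'I_3}) : {ffun G -> 'I_3} :=
  [ffun v => if v \in K then chi v else ord0].
have -> : (3 ^ #|K| = #|pffun_on (ord0 : 'I_3) (mem K) predT|)%N.
  by rewrite card_pffun_on card_ord.
rewrite -(card_in_imset (f := g)); last first.
  move=> chi chi'; rewrite 2!inE 2![in X in _ -> X -> _]inE.
  case/andP => /and3P [p _ _] /eqP [eA eW] /andP [/and3P [p' _ _] /eqP [eA' eW']] gg.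
  have agree v : v \in K -> chi v = chi' v.
    by move=> vK; move/ffunP/(_ v): gg; rewrite !ffunE vK.
  have onY f v : Y :\: colour_class f Y i = W -> v \in Y -> v \notin W -> f v = i.
    by move=> <- vY; rewrite !inE vY /= andbT negbK => /eqP.
  apply/ffunP => v.
  have [vK|] := boolP (v \in K); first exact: agree.
  rewrite !inE negb_or negb_and => /andP [vW].
  have [vX|] := boolP (v \in X); last first.
    rewrite (notin_bipartition bip) => vY _.
    by rewrite (onY chi v eW vY vW) (onY chi' v eW' vY vW).
  move=> /= /subsetPn [u]; rewrite in_neighbours => vu uW.
  have uY : u \in Y by rewrite -(adj_bipartition bip vu).
  have := proper_adj p vu; have := proper_adj p' vu.
  rewrite (onY chi u eW uY uW) (onY chi' u eW' uY uW) => n1 n2.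
  have : (chi v == c) = (chi' v == c).
    have : (v \in colour_class chi X c) = (v \in colour_class chi' X c) by rewrite eA eA'.
    by rewrite !inE vX.
  exact: third_colour ic n2 n1.
apply: subset_leq_card; apply/subsetP => _ /imsetP [chi _ ->].
apply/pffun_onP; split=> //; apply/subsetP => v; rewrite supportE ffunE.
by case: (v \in K) => //; rewrite eqxx.
Qed.

(** The pair of sets in [card_phase_fiber] ranges over small subsets of [X] and of [Y]; in the fibre
    bound 3 is rounded up to 4, which gives the last factor. *)
Lemma card_phase (y z : R) : 0 < y -> y <= 1 -> 0 < z -> z <= 1 -> 
  #|phase|%:R <= (1 + y) ^+ #|X| * y `^ (- (alpha * #|Y|%:R))
     * ((1 + z) ^+ #|Y| * z `^ (- (eta * #|Y|%:R))) * 2 `^ (4 * (eta * #|Y|%:R)).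
Proof.
move=> y0 y1 z0 z1.
set a := alpha * _; set b := eta * _.
pose SA := [set A : {set G} | A \subset X & #|A|%:R <= a].
pose SW := [set W : {set G} | W \subset Y & #|W|%:R <= b].
apply: le_trans (_ : #|SA|%:R * #|SW|%:R * 2 `^ (4 * b) <= _); last first.
  rewrite ler_wpM2r ?powR_ge0 // ler_pM //; exact: card_small_subsets.
rewrite -natrM -cardsX; pose K := Num.truncn (2 `^ (4 * b)).
apply: le_trans (_ : (#|setX SA SW| * K)%N%:R <= _); last first.
  by rewrite natrM ler_wpM2l // truncn_le powR_ge0.
rewrite ler_nat; apply: (card_le_fibers
  (f := fun chi => (colour_class chi X c, Y :\: colour_class chi Y i))).
  move=> chi; rewrite inE => /and3P [_ ci cc]; rewrite !inE cc subsetDl andbT /=.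
  apply/andP; split; first by apply/subsetP => v; rewrite inE => /andP [].
  have cY : colour_class chi Y i \subset Y by apply/subsetP => v; rewrite inE => /andP [].
  have := cardsID (colour_class chi Y i) Y; rewrite (setIidPr cY).
  move=> /(congr1 (fun m => m%:R : R)); rewrite natrD => h.
  by move: ci; rewrite /b; lra.
move=> [A W]; rewrite inE /= => /andP [_]; rewrite inE => /andP [_ Wb].
apply: leq_trans (card_phase_fiber A W) _; rewrite truncn_ge_nat ?powR_ge0 //.
apply: le_trans (_ : 2 `^ (4 * #|W|%:R) <= _); last first.
  by rewrite ler_powR ?ler1n // ler_wpM2l.
rewrite -natrM powR_mulrn // -natrX ler_nat.
apply: leq_trans (_ : 4 ^ (2 * #|W|) <= _)%N; first by case: (2 * #|W|)%N => // e; rewrite leq_exp2r.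
by rewrite -[4%N]/(2 ^ 2)%N -expnM mulnA.
Qed.
End OnePhase.
End Phases.

Lemma card_bigcup_le (I T : finType) (F : I -> {set T}) :
  (#|\bigcup_i F i| <= \sum_i #|F i|)%N.
Proof.
elim/big_rec2: _ => [|i m A _ IH]; first by rewrite cards0.
by apply: leq_trans (leq_card_setU _ _) _; rewrite leq_add2l.
Qed.

(** * Decomposition of the barrier *)

Section Barrier.
Variables (R : realType) (G : sgraph) (d : nat).
Hypotheses (d_gt0 : (0 < d)%N) (dreg : regular G d).
Variables (rho : R) (c : 'I_3).

Definition excess (E O : {set G}) (chi : {ffun G -> 'I_3}) : R :=
  #|colour_class chi E c|%:R - #|colour_class chi O c|%:R.

Definition barrier (E O : {set G}) : {set {ffun G -> 'I_3}} :=
  [set chi | proper_colouring chi & `|excess E O chi| <= rho * #|E|%:R].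

Lemma barrierC E O : bipartition E O -> barrier O E = barrier E O.
Proof.
move=> bip; have [eEO _] := card_bipartition d_gt0 dreg bip.
by apply/setP => chi; rewrite !inE /excess distrC eEO.
Qed.

Variables (eps M : R).
Hypotheses (eps_gt0 : 0 < eps) (rho_eps : rho + 4 * eps < 1).

Definition barrier_phase (E O : {set G}) (i : 'I_3) : {set {ffun G -> 'I_3}} :=
  [set chi in barrier E O | (1 - 2 * eps) * #|O|%:R <= #|colour_class chi O i|%:R].

(** If [i = c], the barrier condition makes [c] abundant on both sides, contradicting
    [colour_class_le]. Otherwise [c] has at most [2 * eps * #|O|] vertices on [O], hence at most
    [(rho + 2 * eps) * #|O|] on [E]. *)
Lemma card_barrier_phase (E O : {set G}) (i : 'I_3) :
  (0 < #|E|)%N -> bipartition E O -> 0 <= M ->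
  (i != c -> #|phase E O i c (2 * eps) (rho + 2 * eps)|%:R <= M) ->
  #|barrier_phase E O i|%:R <= M.
Proof.
move=> E_gt0 bip M_ge0 phM; have [eEO _] := card_bipartition d_gt0 dreg bip.
have n_gt0 : 0 < #|O|%:R :> R by rewrite -eEO ltr0n.
have n_gap : (rho + 4 * eps) * #|O|%:R < #|O|%:R by rewrite gtr_pMl.
have [ic|nic] := eqVneq i c.
  rewrite (_ : barrier_phase E O i = set0) ?cards0 //.
  apply/setP => chi; rewrite in_set0 ic; apply/negP; rewrite !inE.
  move=> /andP [/andP [pchi bar] big].
  have := colour_class_le d_gt0 dreg c bip pchi; rewrite -(ler_nat R) natrD => le.
  move: bar; rewrite eEO ler_norml /excess => /andP [lo _].
  suff : #|O|%:R <= (rho + 4 * eps) * #|O|%:R by rewrite leNgt n_gap.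
  by lra.
apply: le_trans (phM nic); rewrite ler_nat; apply: subset_leq_card.
apply/subsetP => chi; rewrite !inE => /andP [/andP [-> bar] big]; rewrite big /=.
have cO : colour_class chi O i \subset O by apply/subsetP => v; rewrite inE => /andP [].
have sub : colour_class chi O c \subset O :\: colour_class chi O i.
  apply/subsetP => v; rewrite !inE => /andP [vO /eqP ->].
  by rewrite vO eq_sym nic.
have := cardsID (colour_class chi O i) O; rewrite (setIidPr cO).
move=> /(congr1 (fun m => m%:R : R)); rewrite natrD => h.
have := subset_leq_card sub; rewrite -(ler_nat R) => le.
move: bar; rewrite eEO ler_norml /excess => /andP [_ hi].
by lra.
Qed.

(** The factor 6 counts a dominating colour and the side it dominates. *)
Lemma card_barrier (E O : {set G}) :
  (0 < #|E|)%N -> bipartition E O -> 0 <= M ->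
  (forall i, i != c -> #|phase E O i c (2 * eps) (rho + 2 * eps)|%:R <= M) ->
  (forall i, i != c -> #|phase O E i c (2 * eps) (rho + 2 * eps)|%:R <= M) ->
  #|barrier E O|%:R <= #|undominated_colourings eps E O|%:R + 6 * M.
Proof.
move=> E_gt0 bip M_ge0 phE phO; have bip' := bipartitionC bip.
have [eEO _] := card_bipartition d_gt0 dreg bip.
have sub : barrier E O \subset undominated_colourings eps E O :|:
    (\bigcup_i barrier_phase E O i :|: \bigcup_i barrier_phase O E i).
  apply/subsetP => chi chiB.
  have pchi : proper_colouring chi by move: chiB; rewrite inE => /andP [].
  rewrite !in_setU inE pchi /=.
  have [/existsP [i di]|_] := boolP (dominated (2 * eps) O chi).
    apply/orP; right; apply/orP; left; apply/bigcupP; exists i => //.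
    by rewrite inE chiB.
  have [/existsP [i di]|//] := boolP (dominated (2 * eps) E chi).
  apply/orP; right; apply/orP; right; apply/bigcupP; exists i => //.
  by rewrite inE barrierC ?chiB.
have := leq_trans (subset_leq_card sub) (leq_trans (leq_card_setU _ _)
  (leq_add (leqnn _) (leq_trans (leq_card_setU _ _)
     (leq_add (card_bigcup_le _) (card_bigcup_le _))))).
rewrite -(ler_nat R) !natrD !natr_sum => /le_trans; apply; rewrite lerD2l.
apply: le_trans (_ : \sum_(i : 'I_3) M + \sum_(i : 'I_3) M <= _).
  apply: lerD; apply: ler_sum => i _; apply: card_barrier_phase => //.
  - exact: phE.
  - by rewrite -eEO.
  - exact: phO.
by rewrite !sumr_const card_ord; lra.
Qed.

End Barrier.

(** * Entropy condition and numerical exponents *)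

Section Constants.
Variable R : realType.

Lemma ln2_gt0 : 0 < ln 2 :> R.
Proof. by rewrite ln_gt0 // ltr1n. Qed.

Lemma ln2_le1 : ln 2 <= 1 :> R.
Proof. by have := @le_ln1Dx R 1; rewrite -[1 + 1]/(2 : R); apply; lra. Qed.

(** For [rho >= 1 / 2] the term [- (1 - rho) * log2 (1 - rho)] alone is at least [1 - rho]. The
    value [rho = 1] is separate, as the estimate on [ln (1 - rho)] needs a positive argument. *)
Lemma entropy_lt_half (rho : R) : rho <= 1 -> binary_entropy rho + rho < 1 -> rho < 1 / 2.
Proof.
move=> rho_le1; rewrite !ltNge; apply: contra => rho_ge; rewrite /binary_entropy /log2.
have [->|rho_lt1] : rho = 1 \/ rho < 1 by case: ltgtP rho_le1; auto.
  by rewrite ln1 mul0r mulr0 subrr mul0r subr0 add0r.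
have l1 : ln rho <= 0 by rewrite ln_le0.
have l2 : ln (1 - rho) <= - ln 2.
  by rewrite -lnV ?posrE // ler_ln ?posrE; lra.
have h1 : 0 <= - rho * (ln rho / ln 2).
  by rewrite mulNr -mulrN -mulNr mulr_ge0 ?divr_ge0 ?oppr_ge0 ?(ltW ln2_gt0) //; lra.
have h2 : ln (1 - rho) / ln 2 <= - 1.
  by rewrite ler_pdivrMr ?ln2_gt0 //; lra.
have : (1 - rho) * (ln (1 - rho) / ln 2) <= (1 - rho) * (- 1).
  by rewrite ler_wpM2l //; lra.
lra.
Qed.

(* With [y = 1 - t] and [t = 1/2 - rho], the Chernoff exponent
   [ln (1 + y) - rho * ln y] is below [ln 2] by a multiple of [t ^ 2]; the
   remaining terms are absorbed by taking [z] and [eps] small. *)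
Lemma phase_exponent (rho : R) : 0 < rho -> rho < 1 / 2 ->
  exists eps y z kappa : R,
   [/\ 0 < eps, eps <= 1 / 10, rho + 4 * eps < 1 & 0 < kappa] /\
   [/\ 0 < y, y <= 1, 0 < z, z <= 1 &
    ln (1 + y) - (rho + 2 * eps) * ln y + (ln (1 + z) - 2 * eps * ln z)
      + 4 * (2 * eps) * ln 2 <= (1 - kappa) * ln 2].
Proof.
move=> rho_gt0 rho_lt; pose t := 1 / 2 - rho; pose z := t ^+ 2 / 64.
have t_gt0 : 0 < t by rewrite /t; lra.
have t_lt : t < 1 / 2 by rewrite /t; lra.
have t2_gt0 : 0 < t ^+ 2 by rewrite exprn_gt0.
have t2_lt : t ^+ 2 < t / 2 by rewrite expr2 ltr_pM2l //; lra.
have z_gt0 : 0 < z by rewrite /z; lra.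
have z_lt1 : z < 1 by rewrite /z; lra.
(* Since [q] dominates both 1 and [- ln z], the choice [eps * q = t ^+ 2 / 512] controls [eps] and
   [- (eps * ln z)] at once. *)
pose q := 1 - ln z.
have q_ge1 : 1 <= q by rewrite /q lerBrDr gerDl ln_le0 // ltW.
have q_gt0 : 0 < q by lra.
pose eps := t ^+ 2 / 512 / q.
have eps_gt0 : 0 < eps by rewrite /eps !divr_gt0.
have eps_q : eps * q = t ^+ 2 / 512 by rewrite /eps divfK ?gt_eqF.
have eps_le : eps <= t ^+ 2 / 512.
  by rewrite -eps_q ler_peMr // ltW.
exists eps, (1 - t), z, (t ^+ 2 / 64); split; first by split; rewrite ?divr_gt0 //; lra.
split; rewrite ?(ltW z_lt1) //; try lra.
have -> : 1 + (1 - t) = 2 * (1 + - (t / 2)) by field.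
rewrite lnM ?posrE //; last by lra.
have h1 : ln (1 + - (t / 2)) <= - (t / 2) by apply: le_ln1Dx; lra.
have h2 : - ln (1 - t) <= t / (1 - t).
  rewrite -lnV ?posrE; last by lra.
  rewrite [X in ln X](_ : _ = 1 + t / (1 - t)); last by field; lra.
  apply: le_ln1Dx; apply: lt_le_trans (_ : 0 <= _); first lra.
  by rewrite divr_ge0 //; lra.
have h3 : (rho + 2 * eps) * - ln (1 - t) <= t / 2 - t ^+ 2 / 8.
  apply: le_trans (_ : (1 / 2 - 3 / 4 * t) * (t / (1 - t)) <= _).
    have : 0 <= t / (1 - t) by rewrite divr_ge0 //; lra.
    have : rho + 2 * eps <= 1 / 2 - 3 / 4 * t by rewrite /t in t2_lt eps_le *; lra.
    have : 0 <= rho + 2 * eps by lra.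
    move: (t / (1 - t)) h2 => w; move: (- ln (1 - t)) => v; move: (rho + 2 * eps) => a; nra.
  rewrite mulrA ler_pdivrMr; last by lra.
  rewrite -subr_ge0.
  have -> : (t / 2 - t ^+ 2 / 8) * (1 - t) - (1 / 2 - 3 / 4 * t) * t
     = (t ^+ 2 + t ^+ 3) / 8 by field.
  by rewrite divr_ge0 ?addr_ge0 ?exprn_ge0 // ltW.
have h4 : ln (1 + z) <= t ^+ 2 / 64 by apply: le_ln1Dx; lra.
have h5 : - (eps * ln z) <= t ^+ 2 / 512.
  by rewrite -eps_q /q mulrBr mulr1 -[X in X <= _]add0r lerD2r ltW.
have h6 : eps * ln 2 <= t ^+ 2 / 512.
  by apply: le_trans eps_le; rewrite ler_piMr ?ln2_le1 // ltW.
have h7 : t ^+ 2 / 64 * ln 2 <= t ^+ 2 / 64.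
  by rewrite ler_piMr ?ln2_le1 //; lra.
(* In units of [t ^+ 2 / 512]: [h3] gains 64, while [h4], [h5] and [h6] cost 8, 2 and 8; by [h7] a
   net gain of 8 suffices. *)
lra.
Qed.

Lemma phase_bound (G : sgraph) (d : nat) (X Y : {set G}) (i c : 'I_3)
    (rho eps y z kappa : R) :
  (0 < d)%N -> regular G d -> bipartition X Y -> i != c ->
  [/\ 0 < y, y <= 1, 0 < z, z <= 1 &
    ln (1 + y) - (rho + 2 * eps) * ln y + (ln (1 + z) - 2 * eps * ln z)
      + 4 * (2 * eps) * ln 2 <= (1 - kappa) * ln 2] ->
  #|phase X Y i c (2 * eps) (rho + 2 * eps)|%:R <= 2 `^ ((1 - kappa) * #|X|%:R).
Proof.
move=> d_gt0 dreg bip ic [y0 y1 z0 z1 le].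
apply: le_trans (card_phase d_gt0 dreg _ _ bip ic y0 y1 z0 z1) _.
have [<- _] := card_bipartition d_gt0 dreg bip; set n := #|X|%:R.
have expE (w : R) : 0 < w -> w ^+ #|X| = expR (n * ln w).
  by move=> w0; rewrite expRM_natl lnK.
have powE (w a : R) : 0 < w -> w `^ a = expR (a * ln w).
  by move=> w0; rewrite /powR gt_eqF.
rewrite !expE ?powE //; try lra.
rewrite -!expRD ler_expR.
apply: le_trans (_ : n * ((1 - kappa) * ln 2) <= _); last by rewrite mulrA [n * _]mulrC.
apply: le_trans (_ : n * (ln (1 + y) - (rho + 2 * eps) * ln y + (ln (1 + z) - 2 * eps * ln z)
      + 4 * (2 * eps) * ln 2) <= _); last by rewrite ler_wpM2l.
by rewrite le_eqVlt; apply/orP; left; apply/eqP; ring.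
Qed.
End Constants.

(** * A bottleneck bound for chains with uniform stationary law *)

Section Bottleneck.
Variables (R : realType) (Omega : finType) (P : Omega -> Omega -> R).
Hypotheses (Pstoch : stochastic P) (Pstat : stationary P (uniform R Omega)).

Lemma step_prob_ge0 t x y : 0 <= step_prob P t x y.
Proof.
case: Pstoch => P_ge0 _; elim: t x => [|t IH] x /=; first by case: (x == y).
by apply: sumr_ge0 => z _; rewrite mulr_ge0.
Qed.

Lemma step_prob_sum1 t x : \sum_y step_prob P t x y = 1.
Proof.
case: Pstoch => _ P1; elim: t x => [|t IH] x /=.
  by rewrite (bigD1 x) //= eqxx big1 ?addr0 // => y; rewrite eq_sym => /negPf ->.
rewrite exchange_big /= -[RHS](P1 x); apply: eq_bigr => z _.
by rewrite -big_distrr /= IH mulr1.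
Qed.

Variables (S B : {set Omega}).
Hypothesis no_jump : forall x y, x \in S -> y \notin S -> y \notin B -> P x y = 0.

(** The chance of being outside [S] at time [t], not of having left it by then. *)
Definition escape t x : R := \sum_(y | y \notin S) step_prob P t x y.

Lemma escape_ge0 t x : 0 <= escape t x.
Proof. by apply: sumr_ge0 => y _; apply: step_prob_ge0. Qed.

Lemma escape_le1 t x : escape t x <= 1.
Proof.
rewrite -(step_prob_sum1 t x) [leRHS](bigID (mem S)) /= lerDr.
by apply: sumr_ge0 => y _; apply: step_prob_ge0.
Qed.

Lemma uniform_column_sum y : (0 < #|Omega|)%N -> \sum_x P x y = 1.
Proof.
move=> O_gt0; have := Pstat y; rewrite /uniform -big_distrr /= => h.
have N0 : #|Omega|%:R != 0 :> R by rewrite pnatr_eq0 -lt0n.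
by apply: (mulfI (invr_neq0 N0)); rewrite h mulr1.
Qed.

(** Condition on the first step. States of [S] reproduce the previous sum because columns of [P] sum
    to 1; each state of [B] outside [S] adds at most 1; no other state is reachable from [S] in one
    step. *)
Lemma escape_sum_le t : (0 < #|Omega|)%N ->
  \sum_(x in S) escape t x <= t%:R * #|B|%:R.
Proof.
move=> O_gt0; case: Pstoch => P_ge0 _.
have part y (A : {set Omega}) : \sum_(x in A) P x y <= 1.
  rewrite -(uniform_column_sum y O_gt0) [leRHS](bigID (mem A)) /= lerDl.
  exact: sumr_ge0.
elim: t => [|t IH].
  rewrite mul0r big1 // => x xS; rewrite /escape big1 //= => y yS.
  by case: eqP => // xy; move: yS; rewrite -xy xS.
have -> : \sum_(x in S) escape t.+1 x = \sum_z escape t z * \sum_(x in S) P x z.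
  rewrite /escape /=; under eq_bigr do rewrite exchange_big /=.
  rewrite exchange_big /=; apply: eq_bigr => z _.
  rewrite big_distrr /=; apply: eq_bigr => x _.
  by rewrite -big_distrr /= mulrC.
rewrite (bigID (mem S)) /= -natr1 mulrDl mul1r lerD //.
  apply: le_trans IH; apply: ler_sum => z _.
  by rewrite ler_piMr ?escape_ge0.
rewrite -sumr_const big_mkcond [leRHS]big_mkcond /=; apply: ler_sum => z _.
have [zS|zS] := boolP (z \in S); first by case: ifP.
have [zB|zB] := boolP (z \in B).
  by rewrite mulr_ile1 ?escape_ge0 ?escape_le1 ?part ?sumr_ge0.
by rewrite big1 ?mulr0 // => x xS; apply: no_jump.
Qed.

(** A bound below 1/2 is what matters: the margin [1 / 2 - 4 / 9 = 1 / 18] is used in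
    [bottleneck_mixing]. *)
Lemma inv_expR1_le : (expR 1)^-1 <= 4 / 9 :> R.
Proof.
rewrite [X in expR X](_ : 1 = 2%:R * 2^-1); last by field.
rewrite expRM_natl.
have h : 3 / 2 <= expR 2^-1 :> R.
  by apply: le_trans (expR_ge1Dx _); lra.
have -> : 4 / 9 = ((3 / 2) ^+ 2)^-1 :> R by field.
by rewrite lef_pV2 ?posrE ?exprn_gt0 ?expR_gt0 ?lerXn2r ?nnegrE ?expR_ge0 //; lra.
Qed.

(** The absolute differences over [S] and over its complement each dominate the discrepancy in the
    mass of that complement, so half their sum does too. *)
Lemma escape_tv_dist t x :
  (1 - #|S|%:R / #|Omega|%:R) - tv_dist P t (uniform R Omega) <= escape t x.
Proof.
have := @le_bigmax _ _ _ (0 : R)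
  (fun x => 2^-1 * \sum_y `|step_prob P t x y - uniform R Omega y|) x.
rewrite -/(tv_dist P t (uniform R Omega)) => tv.
have O_gt0 : (0 < #|Omega|)%N by apply/card_gt0P; exists x.
have N0 : #|Omega|%:R != 0 :> R by rewrite pnatr_eq0 -lt0n.
have uS : \sum_(y in S) uniform R Omega y = #|S|%:R / #|Omega|%:R.
  by rewrite /uniform sumr_const -[LHS]mulr_natl.
have uT : \sum_y uniform R Omega y = 1.
  by rewrite /uniform sumr_const -[LHS]mulr_natl mulfV.
have s1 : \sum_(y in S) step_prob P t x y + escape t x = 1.
  by rewrite -(step_prob_sum1 t x) [RHS](bigID (mem S)).
have u1 : \sum_(y in S) uniform R Omega y + \sum_(y | y \notin S) uniform R Omega y = 1.
  by rewrite -[RHS]uT [RHS](bigID (mem S)).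
rewrite (bigID (mem S)) in tv.
have h1 : \sum_(y in S) (step_prob P t x y - uniform R Omega y)
    <= \sum_(y in S) `|step_prob P t x y - uniform R Omega y|.
  by apply: ler_sum => y _; apply: ler_norm.
have h2 : \sum_(y | y \notin S) (uniform R Omega y - step_prob P t x y)
    <= \sum_(y | y \notin S) `|step_prob P t x y - uniform R Omega y|.
  by apply: ler_sum => y _; rewrite distrC; apply: ler_norm.
move: h1 h2 tv s1 u1; rewrite !sumrB uS -/(escape t x) /=; lra.
Qed.

Lemma bottleneck_mixing t :
  (0 < #|Omega|)%N -> (2 * #|S| <= #|Omega|)%N ->
  tv_dist P t (uniform R Omega) <= (expR 1)^-1 ->
  #|S|%:R <= 18 * t%:R * #|B|%:R :> R.
Proof.
move=> O_gt0 S_half tv.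
have half : #|S|%:R / #|Omega|%:R <= 1 / 2 :> R.
  rewrite ler_pdivrMr ?ltr0n //; move: S_half; rewrite -(ler_nat R) natrM; lra.
have : \sum_(x in S) (1 / 18 : R) <= \sum_(x in S) escape t x.
  apply: ler_sum => x _; have := escape_tv_dist t x; have := inv_expR1_le; lra.
rewrite sumr_const => /le_trans /(_ (escape_sum_le t O_gt0)).
by rewrite -mulr_natl; lra.
Qed.

End Bottleneck.

(** * Colour symmetry and the resulting mixing time bound *)

Section Symmetry.
Variables (R : realType) (G : sgraph) (d : nat) (rho : R).
Hypotheses (d_gt0 : (0 < d)%N) (dreg : regular G d) (rho_ge0 : 0 <= rho).
Implicit Types (E O : {set G}) (c : 'I_3) (chi : {ffun G -> 'I_3}).

Definition proper_colourings : {set {ffun G -> 'I_3}} := [set chi | proper_colouring chi].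

Definition high E O c : {set {ffun G -> 'I_3}} :=
  [set chi | proper_colouring chi & rho * #|E|%:R < excess R c E O chi].

Lemma sum_excess E O chi : #|E| = #|O| -> \sum_c excess R c E O chi = 0.
Proof.
by move=> eEO; rewrite /excess sumrB -!natr_sum !sum_card_classes eEO subrr.
Qed.

(** Transposing the colours [c] and [c'] is injective on proper colourings and carries one excess to
    the other. *)
Lemma card_high_le E O c c' : (#|high E O c| <= #|high E O c'|)%N.
Proof.
pose recolour chi : {ffun G -> 'I_3} := [ffun v => tperm c c' (chi v)].
have inj : injective recolour.
  by move=> f g /ffunP fg; apply/ffunP => v; move: (fg v); rewrite !ffunE => /perm_inj.
rewrite -(card_imset (mem (high E O c)) inj); apply: subset_leq_card.
apply/subsetP => _ /imsetP [chi + ->]; rewrite !inE => /andP [pchi big].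
apply/andP; split.
  apply/forallP => x; apply/forallP => y; apply/implyP => xy.
  by rewrite !ffunE (inj_eq perm_inj) (proper_adj pchi).
have cls A : colour_class (recolour chi) A c' = colour_class chi A c.
  apply/setP => v; rewrite !inE ffunE.
  by rewrite -(inj_eq (@perm_inj _ (tperm c c')) (chi v) c) tpermL.
by rewrite /excess !cls.
Qed.

(** A colouring outside all these sets would have three negative excesses, but the excesses sum to
    0. *)
Lemma card_proper_le E O (b : R) c :
  bipartition E O -> (forall c, #|barrier rho c E O|%:R <= b) ->
  #|proper_colourings|%:R <= 3 * b + 3 * #|high E O c|%:R.
Proof.
move=> bip barb; have [eEO _] := card_bipartition d_gt0 dreg bip.
have sub : proper_colourings \subset
    \bigcup_c barrier rho c E O :|: \bigcup_c high E O c.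
  apply/subsetP => chi; rewrite inE => pchi; rewrite in_setU.
  apply: contraT; rewrite negb_or => /andP [/bigcupP nb /bigcupP nh].
  have neg c' : excess R c' E O chi < - (rho * #|E|%:R).
    have h1 : excess R c' E O chi <= rho * #|E|%:R.
      by rewrite leNgt; apply/negP => h; apply: nh; exists c' => //; rewrite inE pchi.
    rewrite ltNge; apply/negP => h; apply: nb; exists c' => //.
    by rewrite inE pchi ler_norml h h1.
  have : \sum_c' excess R c' E O chi < 0.
    rewrite !big_ord_recl big_ord0.
    have := neg ord0; have := neg (lift ord0 ord0); have := neg (lift ord0 (lift ord0 ord0)).
    have : 0 <= rho * #|E|%:R by rewrite mulr_ge0.
    lra.
  by rewrite sum_excess // ltxx.
have := leq_trans (subset_leq_card sub) (leq_trans (leq_card_setU _ _)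
  (leq_add (card_bigcup_le _) (card_bigcup_le _))).
rewrite -(ler_nat R) natrD !natr_sum => /le_trans; apply.
apply: le_trans (_ : \sum_(i : 'I_3) b + \sum_(i : 'I_3) #|high E O c|%:R <= _).
  by apply: lerD; apply: ler_sum => i _ //; rewrite ler_nat card_high_le.
by rewrite !sumr_const card_ord; lra.
Qed.

(** Use one colour on [E] and choose freely between the other two on [O]. *)
Lemma card_proper_ge E O : bipartition E O -> (2 ^ #|E| <= #|proper_colourings|)%N.
Proof.
move=> bip; have [-> _] := card_bipartition d_gt0 dreg bip.
pose a1 : 'I_3 := inord 1; pose a2 : 'I_3 := inord 2.
have a01 : ord0 != a1 by rewrite -val_eqE /= inordK.
have a02 : ord0 != a2 by rewrite -val_eqE /= inordK.
have a12 : a1 != a2 by rewrite -val_eqE /= !inordK.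
pose f (W : {set G}) : {ffun G -> 'I_3} :=
  [ffun v => if v \in E then ord0 else if v \in W then a1 else a2].
rewrite -card_powerset -(card_in_imset (f := f)); last first.
  move=> W W'; rewrite !inE => /subsetP WO /subsetP W'O /ffunP ff; apply/setP => v.
  move: (ff v); rewrite !ffunE; have [vE _|vE] := boolP (v \in E).
    have vO : v \notin O by rewrite -(notin_bipartition bip) vE.
    by rewrite (contraNF (WO v) vO) (contraNF (W'O v) vO).
  by do 2?[case: (v \in _)] => // /eqP; rewrite ?(negPf a12) // eq_sym (negPf a12).
apply: subset_leq_card; apply/subsetP => _ /imsetP [W _ ->]; rewrite inE.
apply/forallP => x; apply/forallP => y; apply/implyP => xy; rewrite !ffunE.
have := adj_bipartition bip xy; rewrite -(notin_bipartition bip).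
case: (x \in E) => [/esym/negPf -> | /esym/negbFE ->].
  by case: (y \in W).
by case: (x \in W); rewrite eq_sym.
Qed.

Lemma excess_lipschitz E O c chi chi' : bipartition E O ->
  excess R c E O chi - excess R c E O chi' <= #|[set v | chi v != chi' v]|%:R.
Proof.
move=> bip; set D := [set v | _].
have sub (f g : {ffun G -> 'I_3}) (A : {set G}) : [set v | f v != g v] = D ->
    #|colour_class f A c|%:R <= #|colour_class g A c|%:R + #|D :&: A|%:R :> R.
  move=> fgD; rewrite -natrD ler_nat.
  apply: leq_trans (leq_card_setU _ _); apply: subset_leq_card.
  apply/subsetP => v; rewrite -fgD !inE => /andP [-> /eqP fc] /=; rewrite andbT.
  by rewrite -fc eq_sym; case: eqP.
have h1 := sub chi chi' E erefl.
have h2 := sub chi' chi O (_ : _ = D).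
have {}h2 : #|colour_class chi' O c|%:R <= #|colour_class chi O c|%:R + #|D :&: O|%:R :> R.
  by apply: h2; apply/setP => v; rewrite !inE eq_sym.
have : #|D|%:R = #|D :&: E|%:R + #|D :&: O|%:R :> R.
  have EO : ~: E = O by apply/setP => v; rewrite inE (notin_bipartition bip).
  by rewrite -natrD -(cardsID E D) setDE EO.
by rewrite /excess; lra.
Qed.

Lemma card_colouring : #|colouring G| = #|proper_colourings|.
Proof. by rewrite card_sig cardsE. Qed.

Lemma card_preim_colouring (F : {set {ffun G -> 'I_3}}) :
  F \subset proper_colourings -> #|[set chi : colouring G | val chi \in F]| = #|F|.
Proof.
move=> /subsetP Fp; rewrite -(card_imset _ val_inj); apply: eq_card => chi.
apply/imsetP/idP => [[psi + ->]|chiF]; first by rewrite inE.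
have pchi : proper_colouring chi by have := Fp _ chiF; rewrite inE.
by exists (Sub chi pchi); rewrite ?inE SubK.
Qed.

Lemma mixing_time_side E O c P t : bipartition E O ->
  (2 * #|high E O c| <= #|proper_colourings|)%N ->
  stochastic P -> stationary P (uniform R (colouring G)) -> local_chain rho P ->
  tv_dist P t (uniform R (colouring G)) <= (expR 1)^-1 ->
  #|high E O c|%:R <= 18 * t%:R * #|barrier rho c E O|%:R :> R.
Proof.
move=> bip half Pst Pstat loc tv; have [eEO cG] := card_bipartition d_gt0 dreg bip.
have highP : high E O c \subset proper_colourings.
  by apply/subsetP => chi; rewrite !inE => /andP [].
have barP : barrier rho c E O \subset proper_colourings.
  by apply/subsetP => chi; rewrite !inE => /andP [].
rewrite -(card_preim_colouring highP) -(card_preim_colouring barP).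
apply: (bottleneck_mixing Pst Pstat _ _ _ tv).
(* A local move changes at most [2 * rho * #|E|] vertices, hence the excess by at most that much: it
   cannot cross the barrier. *)
- move=> x y; rewrite !inE (valP x) (valP y) /= => xh yh yb.
  apply/eqP; apply: contraTT xh => /loc diff; rewrite -leNgt.
  have := excess_lipschitz c (val x) (val y) bip.
  have yl : excess R c E O (val y) < - (rho * #|E|%:R).
    rewrite ltNge; apply: contra yb => yl.
    by rewrite ler_norml yl leNgt.
  by move: diff; rewrite cG natrM; lra.
- by rewrite card_colouring (leq_trans _ (card_proper_ge bip)) // expn_gt0.
- by rewrite card_colouring (card_preim_colouring highP).
Qed.
End Symmetry.

Section MixingTime.
Variables (R : realType) (G : sgraph) (d : nat) (rho b : R) (E O : {set G}).
Hypotheses (d_gt0 : (0 < d)%N) (dreg : regular G d) (rho_ge0 : 0 <= rho).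
Hypothesis bip : bipartition E O.
Hypothesis barb : forall c, #|barrier rho c E O|%:R <= b.
Hypothesis b_le : 12 * b <= 2 ^+ #|E|.

(** The sets [high E O c] and [high O E c] are disjoint, so one of them holds at most half of the
    proper colourings, as the bottleneck bound requires. *)
Lemma mixing_time_ge P t :
  stochastic P -> stationary P (uniform R (colouring G)) -> local_chain rho P ->
  tv_dist P t (uniform R (colouring G)) <= (expR 1)^-1 ->
  2 ^+ #|E| <= 72 * t%:R * b.
Proof.
move=> Pst Pstat loc tv; have bip' := bipartitionC bip.
have [eEO _] := card_bipartition d_gt0 dreg bip; pose c : 'I_3 := ord0.
have barb' c' : #|barrier rho c' O E|%:R <= b by rewrite (barrierC d_gt0 dreg _ _ bip).
have P_ge : 2 ^+ #|E| <= #|proper_colourings G|%:R :> R.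
  by rewrite -natrX ler_nat (card_proper_ge d_gt0 dreg bip).
have side (X Y : {set G}) : bipartition X Y -> (forall c', #|barrier rho c' X Y|%:R <= b) ->
    (2 * #|high rho X Y c| <= #|proper_colourings G|)%N -> 2 ^+ #|E| <= 72 * t%:R * b.
  move=> bipXY barXY half.
  have le1 := card_proper_le d_gt0 dreg rho_ge0 c bipXY barXY.
  have le2 := mixing_time_side d_gt0 dreg bipXY half Pst Pstat loc tv.
  have le3 : t%:R * #|barrier rho c X Y|%:R <= t%:R * b by rewrite ler_wpM2l.
  (* As [3 * b] is at most a quarter of [2 ^+ #|E|], the high set has at least a quarter of it; 72
     is 4 * 18. *)
  by move: P_ge b_le; move: (2 ^+ #|E|) => w; lra.
have [h|h] := leqP (2 * #|high rho E O c|) #|proper_colourings G|; first exact: side h.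
apply: (side O E) => //.
have dis : [disjoint high rho E O c & high rho O E c].
  rewrite -setI_eq0; apply/eqP/setP => chi; rewrite in_set0; apply/negP; rewrite !inE.
  move=> /andP [/andP [_ h1] /andP [_ h2]].
  have : 0 <= rho * #|E|%:R by rewrite mulr_ge0.
  have : excess R c O E chi = - excess R c E O chi by rewrite /excess opprB.
  by move: h1 h2; rewrite -eEO; lra.
have sub : high rho E O c :|: high rho O E c \subset proper_colourings G.
  by rewrite subUset; apply/andP; split; apply/subsetP => chi; rewrite !inE => /andP [].
have := subset_leq_card sub; have [_] := leq_card_setU (high rho E O c) (high rho O E c).
by rewrite dis => /eqP ->; lia.
Qed.

End MixingTime.

(** * Parameters of the branching in terms of the degree *)

Lemma ln2_ge_half (R : realType) : 1 / 2 <= ln 2 :> R.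
Proof.
have : ln (1 + - (1 / 2)) <= - (1 / 2) :> R by apply: le_ln1Dx; lra.
have -> : 1 + - (1 / 2) = 2^-1 :> R by field.
by rewrite lnV ?posrE //; lra.
Qed.

Lemma log2_ge1 (R : realType) (d : nat) : (2 <= d)%N -> 1 <= log2 d%:R :> R.
Proof.
move=> d2; have d0 : (0 < d)%N := ltnW d2.
by rewrite /log2 ler_pdivlMr ?ln2_gt0 // mul1r ler_ln ?posrE ?ltr0n // ler_nat.
Qed.

Lemma powR_log2 (R : realType) (d : nat) : (0 < d)%N -> 2 `^ (log2 d%:R) = d%:R :> R.
Proof.
move=> d0; rewrite /powR gt_eqF // /log2 divfK ?gt_eqF ?ln2_gt0 //.
by rewrite lnK // posrE ltr0n.
Qed.

(** The branching uses [r = d %/ 8] and [k = d %/ 16]. *)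
Lemma degree_div_bounds (d : nat) : (32 <= d)%N ->
  [/\ (d <= 32 * (d %/ 16))%N, (8 * (d %/ 8) <= d)%N & ((d %/ 16).*2 <= d %/ 8)%N].
Proof. by move=> d_ge; split; lia. Qed.

Section Asymptotics.
Variables (R : realType) (G : sgraph) (d : nat) (delta eps : R) (E O : {set G}).
Hypotheses (d_ge : (32 <= d)%N) (dreg : regular G d) (bip : bipartition E O).
Hypothesis dmin : is_bip_expansion E O delta.
Hypotheses (eps_gt0 : 0 < eps) (eps_le : eps <= 1 / 10).

Lemma card_undominated_le :
  4000 / eps * (log2 d%:R / d%:R) <= delta ->
  #|undominated_colourings eps E O|%:R
    <= 2 `^ (#|E|%:R - eps / 50 * (delta * #|E|%:R)) :> R.
Proof.
move=> delta_ge; have d_gt0 : (0 < d)%N := leq_trans (isT : (0 < 32)%N) d_ge.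
have [dk rd kr] := degree_div_bounds d_ge.
have [eEO cG] := card_bipartition d_gt0 dreg bip.
have d0 : 0 < d%:R :> R by rewrite ltr0n.
have L1 : 1 <= log2 d%:R :> R by apply: log2_ge1; apply: leq_trans d_ge.
set lg := log2 d%:R in delta_ge L1 *.
have Ld_gt0 : 0 < lg / d%:R by rewrite divr_gt0 //; lra.
have delta_ge0 : 0 <= delta.
  by apply: le_trans delta_ge; rewrite mulr_ge0 ?(ltW Ld_gt0) // divr_ge0 // ltW.
have n_gt0 : 0 < #|E|%:R :> R.
  by rewrite ltr0n (leq_trans d_gt0 (degree_le_side d_gt0 dreg bip dmin)).
have [T [domT cT]] := dominating_set R d_gt0 dreg (card_gt0_of_expansion dmin).
(* Chosen so that [x ^+ k >= d] and [x - 1 >= 1 / d], whose product gives [xk]. *)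
pose a := 32 * (lg / d%:R); pose x := 2 `^ a; pose k := (d %/ 16)%N.
have a_gt0 : 0 < a by rewrite mulr_gt0.
have two1 : 1 <= 2 :> R by rewrite ler1n.
have x_ge1 : 1 <= x by rewrite -(powRr0 2) ler_powR // ltW.
have k_ge : d%:R <= 32 * k%:R :> R.
  by move: dk; rewrite -(ler_nat R) natrM.
have xk : 1 <= x ^+ k * (x - 1).
  have x1 : d%:R^-1 <= x - 1.
    rewrite lerBrDl /x /powR gt_eqF //; apply: le_trans (expR_ge1Dx _); rewrite lerD2l.
    have : lg / d%:R * (1 / 2) <= lg / d%:R * ln 2 by rewrite ler_pM2l // ln2_ge_half.
    have : d%:R^-1 <= lg / d%:R by rewrite ler_peMl // invr_ge0 ltW.
    rewrite /a; lra.
  have xk : d%:R <= x ^+ k.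
    rewrite -powR_mulrn ?powR_ge0 // -powRrM -(powR_log2 R d_gt0) ler_powR // -/lg /a.
    rewrite -(@ler_pM2r _ d%:R) // [leRHS](_ : _ = lg * (32 * k%:R)); last by field; rewrite gt_eqF.
    by rewrite ler_pM2l //; lra.
  apply: le_trans (_ : d%:R * d%:R^-1 <= _); first by rewrite divff // gt_eqF.
  by rewrite ler_pM // ?invr_ge0 ltW.
have bnd := undominated_bound d_gt0 dreg delta_ge0 bip dmin eps_gt0 eps_le rd x_ge1 xk kr domT.
apply: le_trans bnd _.
have T_le : #|T|%:R <= 8 * (lg / d%:R * #|E|%:R).
  apply: le_trans cT _; rewrite cG natrM.
  have ln_le : ln d%:R + 3 <= 4 * lg.
    have : ln d%:R = lg * ln 2 by rewrite /lg /log2 divfK // gt_eqF // ln2_gt0.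
    have : lg * ln 2 <= lg by rewrite ler_piMr ?ln2_le1 //; lra.
    by lra.
  have : 2 * #|E|%:R / d%:R * (ln d%:R + 3) <= 2 * #|E|%:R / d%:R * (4 * lg) :> R.
    by rewrite ler_wpM2l // divr_ge0 ?mulr_ge0 // ltW.
  by move/le_trans; apply; rewrite le_eqVlt; apply/orP; left; apply/eqP; field; rewrite gt_eqF.
have three_T : 3 ^+ #|T| <= 2 `^ (2 * #|T|%:R) :> R.
  rewrite -natrM powR_mulrn // exprM lerXn2r ?nnegrE //; lra.
apply: le_trans (_ : 2 `^ (2 * #|T|%:R) *
   (2 `^ (#|E|%:R - delta * (eps * #|E|%:R) / 25) * 2 `^ (a * #|G|%:R)) <= _).
  have -> : x ^+ #|G| = 2 `^ (a * #|G|%:R) by rewrite powRrM powR_mulrn ?powR_ge0.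
  by rewrite ler_wpM2r ?mulr_ge0 ?powR_ge0.
have two0 : (2 : R) != 0 by rewrite pnatr_eq0.
rewrite -!powRD ?two0 ?implybT // ler_powR // cG natrM /a.
(* The dominating set costs at most [16 * w] and the branching [64 * w]; together
   [80 * eps / 4000 = eps / 50], half of the saving [eps / 25]. *)
set w := lg / d%:R * #|E|%:R in T_le.
have w_le : w <= eps / 4000 * (delta * #|E|%:R).
  have -> : w = eps / 4000 * (4000 / eps * (lg / d%:R) * #|E|%:R).
    by rewrite /w; field; rewrite !gt_eqF.
  by rewrite ler_wpM2l ?divr_ge0 ?(ltW eps_gt0) // ler_wpM2r // ltW.
have -> : 32 * (lg / d%:R) * (2 * #|E|%:R) = 64 * w by rewrite /w; ring.
lra.
Qed.
End Asymptotics.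

(** * Choice of the final constants and the mixing time bound *)

Unset Implicit Arguments.

Theorem theorem1p1 (R : realType) (rho : R)
    (rho_gt0 : 0 < rho) (rho_le1 : rho <= 1)
    (rho_entropy : binary_entropy rho + rho < 1) :
  exists d0 C1 C1' C2 : R,
    [/\ 0 < d0, 0 < C1, 0 < C1' & 0 < C2] /\
    forall (G : sgraph) (E O : {set G}) (d l : nat) (delta : R),
      bipartition E O -> regular G d ->
      is_bip_expansion E O delta ->
      is_locality G d l -> (0 < l)%N ->
      Num.max (C1 * log2 d%:R ^+ 3 / d%:R) (C1' * log2 d%:R / l%:R) <= delta ->
      d0 <= d%:R ->
      forall P : colouring G -> colouring G -> R,
        stochastic P -> ergodic P ->
        stationary P (uniform R (colouring G)) ->
        local_chain rho P ->
        forall tau : nat, is_mixing_time P (uniform R (colouring G)) tau ->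
          2 `^ (C2 * #|G|%:R * delta / log2 d%:R) <= tau%:R.
Proof.
have [eps [y [z [kappa [[eps_gt0 eps_le rho_eps kappa_gt0] exponent]]]]] :=
  phase_exponent rho_gt0 (entropy_lt_half rho_le1 rho_entropy).
(* The smaller of the savings for undominated colourings and for phases; [delta <= 1] makes them
   comparable. *)
pose c2 := Num.min (eps / 50) kappa.
have c2_gt0 : 0 < c2 by rewrite lt_min divr_gt0.
have c2_eps : c2 <= eps / 50 by rewrite ge_min lexx.
have c2_kappa : c2 <= kappa by rewrite ge_min lexx orbT.
have C1_gt0 : 0 < 4000 / eps + 18 / c2 by rewrite addr_gt0 ?divr_gt0.
(* The summand [4000 / eps] serves [card_undominated_le], and [18 / c2] makes [h] below at least 9.
   With [#|G| = 2 * #|E|], the factor [c2 / 4] turns the claimed exponent into [h / log2 d]. *)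
exists 32, (4000 / eps + 18 / c2), 1, (c2 / 4); split.
  by split=> //; rewrite divr_gt0.
move=> G E O d l delta bip dreg dmin _ _.
rewrite ge_max => /andP [delta_ge _] d_ge P Pst _ Pstat loc tau [tv _].
have {}d_ge : (32 <= d)%N by rewrite -(ler_nat R).
have d_gt0 : (0 < d)%N := leq_trans (isT : (0 < 32)%N) d_ge.
have [eEO cG] := card_bipartition d_gt0 dreg bip.
have dR_gt0 : 0 < d%:R :> R by rewrite ltr0n.
have lg_ge1 : 1 <= log2 d%:R :> R by apply: log2_ge1; apply: leq_trans d_ge.
have lg_gt0 : 0 < log2 d%:R :> R := lt_le_trans ltr01 lg_ge1.
have n_ge : d%:R <= #|E|%:R :> R by rewrite ler_nat (degree_le_side d_gt0 dreg bip dmin).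
have lg3_ge : log2 d%:R <= log2 d%:R ^+ 3 :> R by rewrite ler_eXnr.
have delta_lg : (4000 / eps + 18 / c2) * (log2 d%:R / d%:R) <= delta.
  apply: le_trans delta_ge; rewrite -mulrA ler_pM2l // ler_pM2r ?invr_gt0 //.
have lgd_gt0 : 0 < log2 d%:R / d%:R :> R by rewrite divr_gt0.
have delta1 : 4000 / eps * (log2 d%:R / d%:R) <= delta.
  apply: le_trans delta_lg; rewrite ler_wpM2r ?(ltW lgd_gt0) // lerDl.
  by rewrite divr_ge0 // ltW.
have delta_ge0 : 0 <= delta.
  by apply: le_trans delta1; rewrite mulr_ge0 ?(ltW lgd_gt0) // divr_ge0 // ltW.
have delta_le1 := bip_expansion_le1 d_gt0 dreg dmin.
have n_gt0 : 0 < #|E|%:R :> R by apply: lt_le_trans n_ge.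
have delta2 : 18 / c2 <= delta * #|E|%:R.
  apply: le_trans (_ : delta * d%:R <= _); last by rewrite ler_wpM2l.
  rewrite -ler_pdivrMr // ; apply: le_trans delta_lg.
  apply: le_trans (_ : 18 / c2 * (log2 d%:R / d%:R) <= _).
    by rewrite ler_pM2l ?divr_gt0 // ler_peMl ?invr_ge0 // ltW.
  by rewrite ler_wpM2r ?(ltW lgd_gt0) // lerDr divr_ge0 // ltW.
(* Half of the saving: of the two factors [v], one absorbs the constants and the other is the lower
   bound. *)
pose h := c2 * (delta * #|E|%:R) / 2; pose v : R := 2 `^ h.
have h_ge : 9 <= h.
  have : c2 * (18 / c2) <= c2 * (delta * #|E|%:R) by rewrite ler_pM2l.
  by rewrite mulrCA divff ?gt_eqF // /h; clear; lra.
have two1 : 1 <= 2 :> R by rewrite ler1n.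
have two0 : (2 : R) != 0 by rewrite pnatr_eq0.
have v_ge : 512 <= v.
  apply: le_trans (_ : 2 `^ 9 <= _); last by rewrite ler_powR.
  by rewrite powR_mulrn //; clear; lra.
have v_gt0 : 0 < v by rewrite powR_gt0.
pose b : R := 7 * (2 ^+ #|E| / (v * v)).
have powE : 2 `^ (#|E|%:R - c2 * (delta * #|E|%:R)) = 2 ^+ #|E| / (v * v) :> R.
  rewrite -powRD ?two0 ?implybT // -powRN -powR_mulrn // -powRD ?two0 ?implybT //.
  by congr (_ `^ _); rewrite /h; field.
have barb c : #|barrier rho c E O|%:R <= b.
  have M_ge0 : 0 <= 2 `^ ((1 - kappa) * #|E|%:R) :> R := powR_ge0 _ _.
  have E_gt0 : (0 < #|E|)%N by rewrite -(ltr0n R).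
  have phE i : i != c -> #|phase E O i c (2 * eps) (rho + 2 * eps)|%:R
      <= 2 `^ ((1 - kappa) * #|E|%:R).
    by move=> ic; apply: (phase_bound d_gt0 dreg _ ic exponent).
  have phO i : i != c -> #|phase O E i c (2 * eps) (rho + 2 * eps)|%:R
      <= 2 `^ ((1 - kappa) * #|E|%:R).
    by move=> ic; rewrite eEO; apply: (phase_bound d_gt0 dreg (bipartitionC bip) ic exponent).
  apply: le_trans (card_barrier d_gt0 dreg rho_eps E_gt0 bip M_ge0 phE phO) _.
  have und := card_undominated_le d_ge dreg bip dmin eps_gt0 eps_le delta1.
  have dn_ge0 : 0 <= delta * #|E|%:R by rewrite mulr_ge0.
  have {}und : #|undominated_colourings eps E O|%:R <= 2 ^+ #|E| / (v * v) :> R.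
    apply: le_trans und _; rewrite -powE ler_powR // lerD2l lerN2.
    by rewrite ler_wpM2r.
  have ph : 2 `^ ((1 - kappa) * #|E|%:R) <= 2 ^+ #|E| / (v * v) :> R.
    rewrite -powE ler_powR // mulrBl mul1r lerD2l lerN2.
    by rewrite ler_pM ?(ltW c2_gt0) // ler_piMl // ltW.
  by rewrite /b; move: und ph; clear; lra.
have E2_gt0 : 0 < 2 ^+ #|E| :> R by rewrite exprn_gt0.
have vv : 512 * v <= v * v by rewrite ler_pM2r.
have b_le : 12 * b <= 2 ^+ #|E|.
  rewrite /b !mulrA ler_pdivrMr ?mulr_gt0 // [leRHS]mulrC ler_pM2r //; move: v_ge vv; clear; lra.
have := mixing_time_ge d_gt0 dreg (ltW rho_gt0) bip barb b_le Pst Pstat loc tv.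
rewrite /b !mulrA ler_pdivlMr ?mulr_gt0 // mulrC ler_pM2r // => vtau.
apply: le_trans (_ : v <= _).
  rewrite ler_powR // cG natrM ler_pdivrMr //.
  apply: le_trans (_ : h * 1 <= _); last by rewrite ler_pM2l //; move: lg_ge1 h_ge; clear; lra.
  by rewrite /h; clear; lra.
(* The constants multiply to 72 * 7 = 504, below the 512 supplied by one factor [v]. *)
rewrite -(@ler_pM2l _ 512) //; move: v_gt0 vv vtau; clear; lra.
Qed.
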